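(* Let $N\ge1$, $R>0$, $\alpha\in\mathbb{R}$, and let $\gamma:=1-\alpha$. Let $\Phi$ be an Orlicz function. In each of (i)–(iv) below, $C$ denotes a positive constant independent of $u$ whose existence is asserted. (i) If $\gamma<N/p_\Phi^\oplus$, then there is $C$ such that $$(\mathrm{H}_{\mathrm{loc}})\qquad\int_{\mathbb{R}^N}\Phi\left(\frac{|u(x)|}{|x|^\gamma}\right)dx\le C\int_{\mathbb{R}^N}\Phi\left(|x|^\alpha|\nabla u(x)|\right)dx\qquad\text{for all }u\in\mathcal{C}_c^1(\mathbb{R}^N).$$ (ii) If $\gamma>N/p_\Phi^\ominus$, then there is $C$ such that $$\int_{\mathbb{R}^N}\Phi\left(\frac{|u(x)|}{|x|^\gamma}\right)dx\le C\int_{\mathbb{R}^N}\Phi\left(|x|^\alpha|\nabla u(x)|\right)dx\qquad\text{for all }u\in\mathcal{C}_c^1(\mathbb{R}^N\setminus\{0\}).$$ (iii) If $p_\Phi^\oplus$ is attained and $\gamma=N/p_\Phi^\oplus$, then there is $C$ such that for every $u\in\mathcal{C}_c^1(\mathbb{R}^N)$ with $\mathrm{supp}(u)\subset B_R(0)$, $$\int_{B_R(0)}\frac{\Phi(|x|^{-\gamma}|u(x)|)}{\big(\log(2R/|x|)\big)^{p_\Phi^\oplus}}\,dx\le C\int_{B_R(0)}\Phi\left(|x|^\alpha|\nabla u(x)|\right)dx.$$ (iv) If $p_\Phi^\ominus$ is attained at $\Psi\asymp\Phi$ and $\gamma=N/p_\Phi^\ominus$, then there is $C$ such that for every $u\in\mathcal{C}_c^1(\mathbb{R}^N)$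 with $\mathrm{supp}(u)\subset B_R(0)^c$, $$\int_{B_R(0)^c}\frac{\Phi(|x|^{-\gamma}|u(x)|)}{\big(\log(2|x|/R)\big)^{p_\Psi^+}}\,dx\le C\int_{B_R(0)^c}\Phi\left(|x|^\alpha|\nabla u(x)|\right)dx.$$ Moreover, if $\gamma>N/p_\Phi^\ominus$, then $(\mathrm{H}_{\mathrm{loc}})$ fails, i.e. it is not true for any constant $C>0$. Furthermore, if $p_\Phi^\ominus$ is attained, then $(\mathrm{H}_{\mathrm{loc}})$ fails also for $\gamma=N/p_\Phi^\ominus$.
   Context: An Orlicz function is a continuous convex function $\Phi:[0,\infty)\to[0,\infty)$ such that $\lim_{t\to0}\Phi(t)/t=0$, $\lim_{t\to\infty}\Phi(t)/t=\infty$, and there is a constant $C>0$ with $\Phi(2t)\le C\Phi(t)$ for all $t\ge0$ (the $\Delta_2$-condition). Such a $\Phi$ can be written $\Phi(t)=\int_0^t\varphi(s)\,ds$, where $\varphi$ (the right derivative of $\Phi$) is non-decreasing and right continuous on $[0,\infty)$, $\varphi(0)=0$, $\varphi(t)>0$ for $t>0$, and $\lim_{t\to\infty}\varphi(t)=\infty$. Define $p_\Phi^-:=\inf_{t>0}\frac{t\varphi(t)}{\Phi(t)}$ and $p_\Phi^+:=\sup_{t>0}\frac{t\varphi(t)}{\Phi(t)}$; one has $1\le p_\Phi^-\le p_\Phi^+<\infty$. Two Orlicz functions $\Phi,\Psi$ are equivalent, written $\Phi\asymp\Psi$, if there are $C_1,C_2>0$ with $C_1\Phi(t)\le\Psi(t)\le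 C_2\Phi(t)$ for all $t\ge0$. Define $p_\Phi^\ominus:=\sup\{p_\Psi^-:\Psi\text{ Orlicz function},\ \Psi\asymp\Phi\}$ and $p_\Phi^\oplus:=\inf\{p_\Psi^+:\Psi\text{ Orlicz function},\ \Psi\asymp\Phi\}$. We say $p_\Phi^\ominus$ (resp. $p_\Phi^\oplus$) is attained at an Orlicz function $\Psi\asymp\Phi$ if $p_\Phi^\ominus=p_\Psi^-$ (resp. $p_\Phi^\oplus=p_\Psi^+$), and that it is attained if it is attained at some such $\Psi$. $B_R(0)$ is the open ball in $\mathbb{R}^N$ centred at the origin with radius $R$, and $B_R(0)^c$ is its complement. $\mathcal{C}_c^1(\Omega)$ is the set of continuously differentiable functions with compact support in $\Omega$; functions in $\mathcal{C}_c^1(\mathbb{R}^N\setminus\{0\})$ are extended by $0$ at the origin. *)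

(* Defs.v *)
From HB Require Import structures.
From mathcomp Require Import all_boot all_order all_algebra.
From mathcomp Require Import all_classical all_reals all_analysis.
Import Order.TTheory GRing.Theory Num.Theory.
Import numFieldNormedType.Exports.

Set Implicit Arguments.
Unset Strict Implicit.
Unset Printing Implicit Defensive.

Local Open Scope classical_set_scope.
Local Open Scope ring_scope.

(* The sigma-algebra generated by the coordinates; for T = R it is the Borel
   sigma-algebra of R^n.  It follows the library's instance on n.-tuple T. *)
Section measurable_rV.
Context {d} {T : measurableType d}.
Variable n : nat.

Let coord : 'I_n -> 'rV[T]_n -> T := fun i v => v ord0 i.

Let rV_set0 : g_sigma_preimage coord set0.
Proof. exact: sigma_algebra0. Qed.

Let rV_setC A : g_sigma_preimage coord A -> g_sigma_preimage coord (~` A).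
Proof. exact: sigma_algebraC. Qed.

Let rV_bigcup (F : _^nat) : (forall i, g_sigma_preimage coord (F i)) ->
  g_sigma_preimage coord (\bigcup_i (F i)).
Proof. exact: sigma_algebra_bigcup. Qed.

HB.instance Definition _ := @isMeasurable.Build (measure_tuple_display d)
  'rV[T]_n (g_sigma_preimage coord) rV_set0 rV_setC rV_bigcup.

Lemma measurable_coord (i : 'I_n) :
  measurable_fun [set: 'rV[T]_n] (fun v => v ord0 i).
Proof.
move=> _ Y mY; rewrite setTI; apply: sub_sigma_algebra => /=.
rewrite -bigcup_seq/=; exists i => /=; first by rewrite mem_index_enum.
by exists Y => //; rewrite setTI.
Qed.

Lemma measurable_fun_rVP d1 (T1 : measurableType d1) (f : T1 -> 'rV[T]_n) :
  (forall i, measurable_fun [set: T1] (fun x => f x ord0 i)) ->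
  measurable_fun [set: T1] f.
Proof.
move=> mf.
suff H : preimage_set_system [set: T1] f (g_sigma_preimage coord) `<=` measurable.
  by move=> _ A mA; apply: H; exists A.
rewrite -[X in X `<=` _]g_sigma_preimageE.
apply: smallest_sub; first exact: sigma_algebra_measurable.
move=> A [B + <-]; rewrite -bigcup_seq/= => -[i _ [C mC <-]].
have := mf i measurableT C mC.
by rewrite !setTI.
Qed.

End measurable_rV.

Section lebesgue_rV.
Context {R : realType}.

Definition rV_cons n (p : measurableTypeR R * 'rV[R]_n) : 'rV[R]_n.+1 :=
  row_mx (const_mx (p.1 : R) : 'rV_1) p.2.

Definition rV_uncons n (v : 'rV[R]_n.+1) : measurableTypeR R * 'rV[R]_n :=
  (v ord0 ord0, @rsubmx R 1 1 n v).

Lemma rV_cons0 n (p : measurableTypeR R * 'rV[R]_n) :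
  rV_cons p ord0 ord0 = p.1.
Proof.
rewrite /rV_cons mxE; case: (splitP (ord0 : 'I_(1 + n))) => // j _.
by rewrite mxE.
Qed.

Lemma rV_consS n (p : measurableTypeR R * 'rV[R]_n) (i : 'I_n) :
  rV_cons p ord0 (lift ord0 i) = p.2 ord0 i.
Proof.
rewrite /rV_cons mxE; case: (splitP (lift ord0 i : 'I_(1 + n))) => k /= ik.
  by move: (ltn_ord k); rewrite -ik.
by congr (p.2 _ _); apply: val_inj; apply/(@addnI 1); rewrite -ik.
Qed.

Lemma rV_consK n : cancel (@rV_cons n) (@rV_uncons n).
Proof.
by move=> [a v]; rewrite /rV_uncons rV_cons0; congr pair; exact: row_mxKr.
Qed.

Lemma rV_unconsK n : cancel (@rV_uncons n) (@rV_cons n).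
Proof.
move=> v; apply/rowP => i; rewrite /rV_uncons /rV_cons /= mxE.
case: (splitP (i : 'I_(1 + n))) => j ij; rewrite mxE.
  by congr (v _ _); apply: val_inj; rewrite /= ij ord1.
by congr (v _ _); apply: val_inj; rewrite /= ij.
Qed.

Lemma measurable_rV_cons n : measurable_fun setT (@rV_cons n).
Proof.
apply: measurable_fun_rVP => i; have [j ->|->] := unliftP ord0 i.
  under eq_fun do rewrite rV_consS.
  exact: (measurableT_comp (measurable_coord j) measurable_snd).
under eq_fun do rewrite rV_cons0.
exact: measurable_fst.
Qed.

Lemma measurable_rV_uncons n : measurable_fun setT (@rV_uncons n).
Proof.
apply/measurable_fun_pairP; split => /=; first exact: measurable_coord.
apply: measurable_fun_rVP => i.
have -> : (fun v => (rV_uncons v).2 ord0 i) =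
    (fun v : 'rV[R]_n.+1 => v ord0 (@rshift 1 n i)).
  by apply/funext => v; rewrite /= mxE.
exact: measurable_coord.
Qed.

Section succ.
Variables (n : nat) (mu : {sigma_finite_measure set 'rV[R]_n -> \bar R}).

Definition lebesgue_rV_succ : set 'rV[R]_n.+1 -> \bar R :=
  pushforward (lebesgue_measure \x mu)%E (@rV_cons n).

Let measurable_preimage A : measurable A -> measurable (@rV_cons n @^-1` A).
Proof.
by move=> mA; rewrite -[X in measurable X]setTI; exact: measurable_rV_cons.
Qed.

Let lebesgue_rV_succ0 : lebesgue_rV_succ set0 = 0%E.
Proof. by rewrite /lebesgue_rV_succ /pushforward preimage_set0 measure0. Qed.

Let lebesgue_rV_succ_ge0 A : (0 <= lebesgue_rV_succ A)%E.
Proof. by rewrite /lebesgue_rV_succ /pushforward measure_ge0. Qed.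

Let lebesgue_rV_succ_sigma_additive : semi_sigma_additive lebesgue_rV_succ.
Proof.
move=> F mF tF mUF; rewrite /lebesgue_rV_succ /pushforward preimage_bigcup.
apply: measure_semi_sigma_additive.
- by move=> k; exact: measurable_preimage.
- apply/trivIsetP => /= i j _ _ ij; rewrite -preimage_setI.
  by move/trivIsetP : tF => /(_ _ _ _ _ ij) ->//; rewrite preimage_set0.
- by rewrite -preimage_bigcup; exact: measurable_preimage.
Qed.

HB.instance Definition _ := isMeasure.Build _ _ _ lebesgue_rV_succ
  lebesgue_rV_succ0 lebesgue_rV_succ_ge0 lebesgue_rV_succ_sigma_additive.

Let lebesgue_rV_succ_sigma_finite : sigma_finite setT lebesgue_rV_succ.
Proof.
have /sigma_finiteP[F [TF ndF Foo]] := sigma_finiteT (@lebesgue_measure R).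
have /sigma_finiteP[G [TG ndG Goo]] := sigma_finiteT mu.
exists (fun k => @rV_uncons n @^-1` (F k `*` G k)).
  apply/esym; rewrite -subTset => v _ /=.
  have [/= i _ Fi] : (\bigcup_i F i) (rV_uncons v).1 by rewrite -TF.
  have [/= j _ Gj] : (\bigcup_j G j) (rV_uncons v).2 by rewrite -TG.
  exists (maxn i j) => //; split.
  - by move: Fi; exact/subsetPset/ndF/leq_maxl.
  - by move: Gj; exact/subsetPset/ndG/leq_maxr.
move=> k; have [mF Fk] := Foo k; have [mG Gk] := Goo k; split.
  rewrite -[X in measurable X]setTI; apply: measurable_rV_uncons => //.
  exact: measurableX.
have FGE : @rV_cons n @^-1` (@rV_uncons n @^-1` (F k `*` G k)) = F k `*` G k.
  by rewrite -comp_preimage (_ : _ \o _ = id)//; apply/funext => p; exact: rV_consK.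
rewrite /lebesgue_rV_succ /pushforward FGE product_measure1E//.
by rewrite lte_mul_pinfty// ge0_fin_numE.
Qed.

HB.instance Definition _ :=
  @Measure_isSigmaFinite.Build _ _ _ lebesgue_rV_succ
    lebesgue_rV_succ_sigma_finite.

End succ.

(* The n-fold product of the one-dimensional Lebesgue measure, transported from
   R * (... * R) to row vectors; see lebesgue_rV_box below. *)
Fixpoint lebesgue_rV n : {sigma_finite_measure set 'rV[R]_n -> \bar R} :=
  match n with
  | 0%N => \d_(0 : 'rV[R]_0)
  | n.+1 => lebesgue_rV_succ (lebesgue_rV n)
  end.

Lemma lebesgue_rV_box n (A : 'I_n -> set (measurableTypeR R)) :
  (forall i, measurable (A i)) ->
  lebesgue_rV n [set v | forall i, A i (v ord0 i)] =
  (\prod_(i < n) lebesgue_measure (A i))%E.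
Proof.
elim: n A => [A _|n IHn A mA] /=.
  by rewrite big_ord0 diracE mem_set// => -[].
pose B := [set v : 'rV[R]_n | forall i, A (lift ord0 i) (v ord0 i)].
have mB : measurable B.
  have -> : B = \bigcap_(i in [set: 'I_n])
      ((fun v : 'rV[R]_n => v ord0 i) @^-1` A (lift ord0 i)).
    apply/seteqP; split => [v Bv i _|v Bv i]; first exact: Bv.
    exact: Bv.
  apply: fin_bigcap_measurable => [|i _]; first exact: finite_finset.
  rewrite -[X in measurable X]setTI; exact: (measurable_coord i measurableT (mA (lift ord0 i))).
rewrite big_ord_recl -(IHn (fun i => A (lift ord0 i))); last by move=> i; exact: mA.
rewrite /lebesgue_rV_succ /pushforward -product_measure1E//.
congr (_ _); apply/seteqP; split => [p /= Ap|p /= [A0 AS] i].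
  split=> [|i]; first by have := Ap ord0; rewrite rV_cons0.
  by rewrite -rV_consS; exact: Ap.
have [j ->|->] := unliftP ord0 i; last by rewrite rV_cons0.
by rewrite rV_consS; exact: AS.
Qed.

End lebesgue_rV.

Section orlicz.
Context {R : realType}.
Implicit Types (Phi Psi : R -> R).

(* A function on [0, +oo) is represented by a total function whose values at
   negative arguments are irrelevant. *)
Record orlicz Phi : Prop := Orlicz {
  orlicz_ge0 : forall t, 0 <= t -> 0 <= Phi t ;
  orlicz_continuous : {within `[0, +oo[, continuous Phi} ;
  orlicz_convex : convex_function (`[0, +oo[%classic : set R) Phi ;
  orlicz_cvg0 : Phi t / t @[t --> 0^'+] --> 0 ;
  orlicz_cvgy : Phi t / t @[t --> +oo] --> +oo ;
  orlicz_Delta2 : exists C, 0 < C /\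
    forall t, 0 <= t -> Phi (2 * t) <= C * Phi t }.

Definition right_derivative Phi (t : R) : R :=
  lim ((Phi (t + h) - Phi t) / h @[h --> 0^'+]).

Definition simonenko Phi : set R :=
  [set t * right_derivative Phi t / Phi t | t in `]0, +oo[].

(* For an Orlicz function, simonenko Phi is a nonempty subset of [1, +oo) that
   is bounded above, so the real-valued inf and sup are the true ones; the same
   holds for the two sets of exponents below. *)
Definition p_minus Phi : R := inf (simonenko Phi).
Definition p_plus Phi : R := sup (simonenko Phi).

Definition orlicz_equiv Phi Psi : Prop :=
  exists C1 C2, [/\ 0 < C1, 0 < C2 &
    forall t, 0 <= t -> C1 * Phi t <= Psi t <= C2 * Phi t].

Definition p_ominus Phi : R :=
  sup [set p_minus Psi | Psi in [set Psi | orlicz Psi /\ orlicz_equiv Psi Phi]].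
Definition p_oplus Phi : R :=
  inf [set p_plus Psi | Psi in [set Psi | orlicz Psi /\ orlicz_equiv Psi Phi]].

Definition ominus_attained_at Phi Psi : Prop :=
  [/\ orlicz Psi, orlicz_equiv Psi Phi & p_ominus Phi = p_minus Psi].
Definition oplus_attained_at Phi Psi : Prop :=
  [/\ orlicz Psi, orlicz_equiv Psi Phi & p_oplus Phi = p_plus Psi].

Definition ominus_attained Phi : Prop := exists Psi, ominus_attained_at Phi Psi.
Definition oplus_attained Phi : Prop := exists Psi, oplus_attained_at Phi Psi.

End orlicz.

Section euclidean.
Context {R : realType} {N : nat}.
Implicit Types (x : 'rV[R]_N) (u : 'rV[R]_N -> R).

(* The norm `|x| that the library puts on 'rV[R]_N is the maximum norm. *)
Definition enorm x : R := Num.sqrt (\sum_(i < N) x ord0 i ^+ 2).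

Definition eball (r : R) : set 'rV[R]_N := [set x | enorm x < r].

Definition grad u x : 'rV[R]_N := \row_i 'D_(delta_mx ord0 i) u x.

Definition supp u : set 'rV[R]_N := closure [set x | u x != 0].

(* A C^1 function with compact support in the open set Omega is identified with
   its extension by 0 to the whole space. *)
Definition C1c (Omega : set 'rV[R]_N) u : Prop :=
  [/\ forall x, Omega x -> differentiable u x /\ {for x, continuous (grad u)},
      compact (supp u) & supp u `<=` Omega].

Definition hardy (alpha gamma : R) (Phi : R -> R) (Omega : set 'rV[R]_N)
    (C : R) : Prop :=
  forall u, C1c Omega u ->
  (\int[lebesgue_rV N]_x (Phi (`|u x| / enorm x `^ gamma))%:E <=
   C%:E * \int[lebesgue_rV N]_x (Phi (enorm x `^ alpha * enorm (grad u x)))%:E)%E.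

End euclidean.

(* Main.v *)
Require Import Defs.
From HB Require Import structures.
From mathcomp Require Import all_boot all_order all_algebra.
From mathcomp Require Import all_classical all_reals all_analysis.
From mathcomp Require Import measurable_realfun ring lra.
Import Order.TTheory GRing.Theory Num.Theory.
Import numFieldNormedType.Exports.

Set Implicit Arguments.
Unset Strict Implicit.
Unset Printing Implicit Defensive.

Local Open Scope classical_set_scope.
Local Open Scope ring_scope.

(** The proof replaces integration along rays by dilations.  Write a(x) for
|u(x)| / |x|^gamma and compare x with lam x, where lam is 2 or 1/2.  The value
a(x) is at most lam^gamma a(lam x) plus an increment, and by the fundamental
theorem of calculus and Jensen's inequality Psi of the increment is controlled
by the mean of Psi(|x|^alpha |grad u|) over the segment from x to lam x
([increment_bound]); integrated over x, this mean costs a constant only, since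
every point of the segment is a dilate of x ([integral_segment_average]).

The indices enter twice.  First, t phi(t) <= p^+ Psi(t) means that Psi(t)/t^p^+
is nonincreasing, and similarly for p^- ([orlicz_scale_plus],
[orlicz_scale_minus]), so that Psi(lam^gamma t) <= theta Psi(t) with theta =
2^(gamma p^+) for lam = 2 (or 1 if gamma < 0) and theta = 2^(- gamma p^-) for
lam = 1/2.  As x = lam^-1 y turns dx into lam^-N dy, the integral of Psi(a) is
bounded by roughly theta / lam^N times itself plus the right-hand side.  If
gamma p^+ < N, dilation by 2 contracts; if gamma p^- > N, dilation by 1/2
contracts; the integral is then absorbed ([dilation_absorption],
[subcritical_hardy]).  The integrals that are absorbed are finite because x is
kept away from the origin, with a constant independent of the distance.

Second, Psi(s + t) <= (1 + C e) Psi(s) + C e^(1 - p^+) Psi(t) for 0 < e <= 1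
([orlicz_add]).  In the borderline cases theta = lam^N there is no contraction,
and the gain comes from a weight L^(1 - p), p = p^+, where L is a logarithm that
increases by ln 2 from x to lam^-1 x: the weight drops by about (p - 1) ln 2 L^-p.
With e = delta / L the loss C e L^(1 - p) is of the same order and smaller, and
the price e^(1 - p) of the increment is exactly cancelled by the weight
([critical_hardy]).  The constant p - 1 is positive because p^+ > 1.

All of this is done for an Orlicz function Psi equivalent to the given one and
whose index is close to the optimal one, or equal to it when it is attained;
equivalence only changes the constant ([hardy_transfer]).

For the negative statements, gamma p^- >= N makes Psi(|x|^-gamma) at least of
order |x|^-N near the origin.  A cutoff function equal to 1 there has an
infinite left-hand side, whereas its gradient is bounded and supported in a
shell ([hardy_fails]). *)

(** * Orlicz functions *)

Section real_lemmas.
Context {R : realType}.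
Implicit Types (f : R -> R) (a b p x y t : R).

(** Cut [a, b] into n equal pieces and let n grow. *)
Lemma quadratic_increment_noninc f a b K : a <= b ->
  (forall x y, a <= x -> x <= y -> y <= b -> f y - f x <= K * (y - x) ^+ 2) ->
  f b <= f a.
Proof.
move=> ab fK; rewrite leNgt; apply/negP => fab.
pose d := f b - f a; have d0 : 0 < d by rewrite subr_gt0.
pose M := K * (b - a) ^+ 2.
have step n : (0 < n)%N -> d * n%:R <= M.
  move=> n0; have nR : 0 < n%:R :> R by rewrite ltr0n.
  pose s k := a + (b - a) * k%:R / n%:R.
  have sD k : s k.+1 - s k = (b - a) / n%:R.
    by rewrite /s -natr1; field; rewrite gt_eqF.
  have -> : d = \sum_(0 <= k < n) (f (s k.+1) - f (s k)).
    rewrite telescope_sumr// /d /s mulr0 mul0r addr0.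
    by congr (f _ - _); field; rewrite gt_eqF.
  have : \sum_(0 <= k < n) (f (s k.+1) - f (s k)) <=
         \sum_(0 <= k < n) (K * ((b - a) / n%:R) ^+ 2).
    apply: ler_sum_nat => k /= kn; rewrite -(sD k); apply: fK.
    - by rewrite /s lerDl divr_ge0// mulr_ge0// subr_ge0.
    - by rewrite -subr_ge0 sD divr_ge0// subr_ge0.
    - rewrite /s -lerBrDl ler_pdivrMr// ler_wpM2l ?subr_ge0//.
      by rewrite ler_nat.
  rewrite sumr_const_nat subn0 => /(ler_wpM2r (ltW nR))/le_trans; apply.
  rewrite -mulr_natr le_eqVlt; apply/orP; left; apply/eqP.
  by rewrite /M; field; rewrite gt_eqF.
have [n nM] : exists n : nat, M / d < n%:R.
  have := archi_boundP (normr_ge0 (M / d)) => Mn.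
  by exists (Num.bound `|M / d|); rewrite (le_lt_trans (ler_norm _)).
have := step n.+1 isT; apply/negP; rewrite -ltNge mulrC -ltr_pdivrMr//.
by rewrite (lt_trans nM)// ltr_nat.
Qed.

Lemma ln_leB1 x : 0 < x -> ln x <= x - 1.
Proof. by move=> x0; have := @le_ln1Dx R (x - 1); rewrite [1 + _]addrC subrK; apply; lra. Qed.

(** By homogeneity it suffices to take x = 1, where y^-p = exp(- p ln y) is at
least 1 - p ln y and ln y <= y - 1. *)
Lemma powR_tangent p x y : 0 <= p -> 0 < x -> 0 < y ->
  x `^ (- p) * (1 - p * (y - x) / x) <= y `^ (- p).
Proof.
move=> p0 x0 y0.
have -> : y = x * (y / x) by field; rewrite gt_eqF.
have r0 : 0 < y / x by rewrite divr_gt0.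
rewrite powRM ?(ltW x0) ?(ltW r0)// ler_wpM2l ?powR_ge0//.
rewrite /powR (gt_eqF r0) (le_trans _ (expR_ge1Dx _))//.
rewrite mulNr lerD2l lerN2 -mulrA ler_wpM2l// (le_trans (ln_leB1 r0))//.
rewrite le_eqVlt; apply/orP; left; apply/eqP; field.
by rewrite gt_eqF.
Qed.

Lemma ler_powRN p x y : 0 <= p -> 0 < x -> x <= y -> y `^ (- p) <= x `^ (- p).
Proof.
move=> p0 x0 xy; have y0 := lt_le_trans x0 xy.
rewrite !powRN lef_pV2 ?posrE ?powR_gt0//.
by rewrite ge0_ler_powR// nnegrE ltW.
Qed.

Lemma powRN_between (s t M c : R) : 0 < s -> s <= t -> t <= M ->
  (t `^ c)^-1 <= (s `^ c)^-1 + (M `^ c)^-1.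
Proof.
move=> s0 st tM; have t0 := lt_le_trans s0 st; have M0 := lt_le_trans t0 tM.
rewrite -!powRN; have [c0|c0] := leP 0 c.
  by rewrite (le_trans (ler_powRN c0 s0 st))// lerDl powR_ge0.
have {}c0 : 0 <= - c by rewrite oppr_ge0 ltW.
rewrite (@le_trans _ _ (M `^ (- c)))//; last by rewrite lerDr powR_ge0.
by rewrite ge0_ler_powR// nnegrE ltW.
Qed.

(** Used for a weight s^c at a point s of a segment from 1 to 2 or to 1/2. *)
Lemma powR_dilation_bnd (s c : R) : 2^-1 <= s <= 2 -> 1 <= 2 `^ `|c| * s `^ c.
Proof.
move=> /andP[s1 s2].
have s0 : 0 < s by apply: lt_le_trans s1; rewrite invr_gt0.
have ls : `|ln s| <= ln 2.
  rewrite ler_norml -lnV ?posrE//; apply/andP.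
  by split; rewrite ler_ln// ?posrE// invr_gt0.
rewrite /powR !gt_eqF// -expRD -[leLHS]expR0 ler_expR.
have : `|c * ln s| <= `|c| * ln 2 by rewrite normrM ler_wpM2l.
by rewrite ler_norml => /andP[]; lra.
Qed.

Lemma powR2_lt1 N (a : R) : a < N%:R -> 2^-1 ^+ N * 2 `^ a < 1.
Proof.
move=> aN; rewrite exprVn ltr_pdivrMl ?exprn_gt0// mulr1 -powR_mulrn//.
by rewrite /powR !gt_eqF// ltr_expR ltr_pM2r// ln_gt0// ltr1n.
Qed.

Lemma powRV2_lt1 N (a : R) : N%:R < a -> 2^-1^-1 ^+ N * 2^-1 `^ a < 1.
Proof.
move=> aN; rewrite invrK -[2^-1]powR_inv1// -powRrM mulN1r -powR_mulrn// -powRD.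
  rewrite /powR gt_eqF// -[X in _ < X]expR0 ltr_expR pmulr_llt0 ?ln_gt0 ?ltr1n//.
  by rewrite subr_lt0.
by rewrite pnatr_eq0 implybT.
Qed.

End real_lemmas.

Section orlicz_theory.
Context {R : realType} {Phi : R -> R}.
Hypothesis HPhi : orlicz Phi.
Implicit Types s t h : R.

Lemma orlicz_conv s t k : 0 <= s -> 0 <= t -> 0 <= k <= 1 ->
  Phi (k * s + (1 - k) * t) <= k * Phi s + (1 - k) * Phi t.
Proof.
move=> s0 t0 /andP[k0 k1].
have := @orlicz_convex _ _ HPhi (Itv01 k0 k1) s t; rewrite !inE/= !in_itv/= !andbT.
by move=> /(_ s0 t0).
Qed.

Lemma orlicz0 : Phi 0 = 0.
Proof.
have c0 : Phi t @[t --> 0^'+] --> Phi 0.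
  have /continuous_within_itvcyP[] := orlicz_continuous HPhi.
  by [].
have c1 : Phi t @[t --> 0^'+] --> (0 : R).
  have idc : t @[t --> (0:R)^'+] --> (0 : R).
    exact: cvg_at_right_filter.
  have := cvgM (orlicz_cvg0 HPhi) idc; rewrite mulr0.
  move=> /(_ _); apply: cvg_trans; apply: near_eq_cvg; near=> t => /=; rewrite divfK// gt_eqF//.
by apply: (cvg_unique _ c0 c1).
Unshelve. all: by end_near. Qed.

Lemma orlicz_ratio s t : 0 <= s -> s <= t -> 0 < t -> Phi s <= s / t * Phi t.
Proof.
move=> s0 st t0.
have := @orlicz_conv t 0 (s / t) (ltW t0) (lexx _).
rewrite divfK ?gt_eqF// orlicz0 !mulr0 !addr0; apply.
by rewrite divr_ge0 ?(ltW t0)// ler_pdivrMr// mul1r.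
Qed.

Lemma orlicz_le s t : 0 <= s -> s <= t -> Phi s <= Phi t.
Proof.
move=> s0 st; have [tz|t0] := eqVneq t 0.
  rewrite tz in st *.
  by have -> : s = 0 by apply/eqP; rewrite eq_le s0 st.
have {}t0 : 0 < t by rewrite lt_neqAle eq_sym t0 (le_trans s0).
apply: (le_trans (orlicz_ratio s0 st t0)).
rewrite -[leRHS]mul1r ler_wpM2r ?(orlicz_ge0 HPhi) ?(ltW t0)//.
by rewrite ler_pdivrMr// mul1r.
Qed.

(** By doubling, a zero at some t > 0 would propagate to the whole half-line. *)
Lemma orlicz_gt0 t : 0 < t -> 0 < Phi t.
Proof.
move=> t0; rewrite lt_neqAle (orlicz_ge0 HPhi (ltW t0)) andbT eq_sym.
apply/negP => /eqP Pt.
have P2 n : Phi (2 ^+ n * t) = 0.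
  elim: n => [|n IHn]; first by rewrite expr0 mul1r.
  have [C [C0 /(_ (2 ^+ n * t))]] := orlicz_Delta2 HPhi.
  have tn : 0 <= 2 ^+ n * t by rewrite mulr_ge0 ?exprn_ge0 ?(ltW t0).
  move=> /(_ tn); rewrite IHn mulr0 mulrA -exprS => Ple; apply/eqP.
  by rewrite eq_le Ple (orlicz_ge0 HPhi)// mulr_ge0 ?exprn_ge0 ?(ltW t0).
have Pz s : 0 <= s -> Phi s = 0.
  move=> s0.
  pose n := Num.bound (s / t).
  have sn : s <= 2 ^+ n * t.
    rewrite -ler_pdivrMr//.
    apply: (le_trans (ltW (archi_boundP (divr_ge0 s0 (ltW t0))))).
    by rewrite -natrX ler_nat ltnW// ltn_expl.
  apply/eqP; rewrite eq_le (orlicz_ge0 HPhi)// andbT -(P2 n).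
  exact: orlicz_le.
have := orlicz_cvgy HPhi => /cvgryPge/(_ 1) [M [Mr HM]].
have := HM (Num.max (M + 1) 1).
have ->/= : (M < Num.max (M + 1) 1) by rewrite lt_max ltrDl ltr01.
rewrite Pz ?mul0r ?le_max ?ler01 ?orbT// => /(_ isT).
by rewrite ler10.
Qed.

Local Notation phi := (right_derivative Phi).

Lemma slope_le s t h k : 0 <= s -> s < t -> 0 < h -> h <= k ->
  (Phi t - Phi s) / (t - s) <= (Phi (t + h) - Phi t) / h <=
  (Phi (t + k) - Phi t) / k.
Proof.
move=> s0 st h0 hk.
have k0 : 0 < k by apply: lt_le_trans hk.
apply/andP; split.
  have d0 : 0 < t + h - s by lra.
  have := @orlicz_conv s (t + h) (h / (t + h - s)) s0.
  have -> : h / (t + h - s) * s + (1 - h / (t + h - s)) * (t + h) = t.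
    by field; rewrite gt_eqF.
  move=> /(_ ltac:(lra)); rewrite divr_ge0 ?(ltW h0) ?(ltW d0)//=.
  rewrite ler_pdivrMr// mul1r => /(_ ltac:(lra)) H.
  rewrite ler_pdivrMr ?subr_gt0// mulrAC ler_pdivlMr//.
  have : Phi t * (t + h - s) <= h * Phi s + (t - s) * Phi (t + h).
    have := ler_wpM2r (ltW d0) H; move/le_trans; apply.
    rewrite le_eqVlt; apply/orP; left; apply/eqP; field.
    by rewrite gt_eqF.
  by lra.
have := @orlicz_conv t (t + k) (1 - h / k).
have -> : (1 - h / k) * t + (1 - (1 - h / k)) * (t + k) = t + h.
  by field; rewrite gt_eqF.
have hk1 : h / k <= 1 by rewrite ler_pdivrMr// mul1r.
have hk0 : 0 <= h / k by rewrite divr_ge0// ltW.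
move=> /(_ ltac:(lra) ltac:(lra) ltac:(lra)) H.
rewrite ler_pdivrMr// mulrAC -mulrA mulrC -mulrA mulrC; lra.
Qed.

Lemma right_derivative_cvg t : 0 < t ->
  (Phi (t + h) - Phi t) / h @[h --> 0^'+] --> phi t.
Proof.
move=> t0; suff : cvg ((Phi (t + h) - Phi t) / h @[h --> 0^'+]) by [].
apply: nondecreasing_at_right_is_cvgr.
  near=> x => h k; rewrite !in_itv/= => /andP[h0 _] _ hk.
  by have /andP[] := @slope_le 0 t h k (lexx _) t0 h0 hk.
near=> x; exists ((Phi t - Phi 0) / (t - 0)) => _ [h /= + <-].
rewrite in_itv/= => /andP[h0 _].
by have /andP[] := @slope_le 0 t h h (lexx _) t0 h0 (lexx _).
Unshelve. all: by end_near. Qed.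

(** Difference quotients increase with their endpoints, so phi(t) separates
the slopes of the chords to the left of t from those to the right. *)
Lemma orlicz_subgradient s t : 0 <= s -> 0 < t ->
  (s - t) * phi t <= Phi s - Phi t.
Proof.
move=> s0 t0; have := right_derivative_cvg t0 => cphi.
have [st|ts|->] := ltgtP s t; last by rewrite !subrr mul0r.
- rewrite -[s - t]opprB mulNr lerNl opprB mulrC -ler_pdivrMr ?subr_gt0//.
  apply: (closed_cvg (fun x => (Phi t - Phi s) / (t - s) <= x)) cphi => //.
  near=> h; have h0 : 0 < h by near: h; exact: nbhs_right_gt.
  by have /andP[] := slope_le s0 st h0 (lexx h).
- rewrite mulrC -ler_pdivlMr ?subr_gt0//.
  apply: (closed_cvg (fun x => x <= (Phi s - Phi t) / (s - t))) cphi => //.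
  near=> h; have h0 : 0 < h by near: h; exact: nbhs_right_gt.
  have hs : h <= s - t.
    by near: h; apply: nbhs_right_le; rewrite subr_gt0.
  have /andP[_] := slope_le (lexx 0) t0 h0 hs.
  by rewrite [t + (s - t)]addrC subrK.
Unshelve. all: by end_near. Qed.

Lemma simonenko_lbound : lbound (simonenko Phi) 1.
Proof.
move=> _ [t + <-]; rewrite /= in_itv/= andbT => t0.
rewrite ler_pdivlMr ?orlicz_gt0// mul1r.
have := @orlicz_subgradient 0 t (lexx _) t0.
by rewrite orlicz0 !sub0r mulNr lerN2.
Qed.

Lemma simonenko_has_ubound : has_ubound (simonenko Phi).
Proof.
have [C [C0 HC]] := orlicz_Delta2 HPhi.
exists C => _ [t + <-]; rewrite /= in_itv/= andbT => t0.
rewrite ler_pdivrMr ?orlicz_gt0//.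
have := @orlicz_subgradient (2 * t) t (mulr_ge0 (ler0n _ 2) (ltW t0)) t0.
have := HC _ (ltW t0); have := orlicz_ge0 HPhi (ltW t0); nra.
Qed.

Lemma simonenko1 t : 0 < t -> simonenko Phi (t * phi t / Phi t).
Proof. by move=> t0; exists t => //=; rewrite in_itv/= andbT. Qed.

Lemma p_minus_ge1 : 1 <= p_minus Phi.
Proof.
apply: lb_le_inf; first by eexists; exact: (simonenko1 ltr01).
exact: simonenko_lbound.
Qed.

Lemma p_minus_le t : 0 < t -> p_minus Phi * Phi t <= t * phi t.
Proof.
move=> t0; rewrite -ler_pdivlMr ?orlicz_gt0//.
apply: ge_inf; last exact: simonenko1.
by exists 1; exact: simonenko_lbound.
Qed.

Lemma p_plus_ge t : 0 < t -> t * phi t <= p_plus Phi * Phi t.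
Proof.
move=> t0; rewrite -ler_pdivrMr ?orlicz_gt0//.
by apply: ub_le_sup; [exact: simonenko_has_ubound|exact: simonenko1].
Qed.

Lemma p_plus_ge1 : 1 <= p_plus Phi.
Proof.
rewrite -[leRHS]mulr1.
have P1 := orlicz_gt0 ltr01.
rewrite -(ler_pM2r P1) mulr1 mul1r.
apply: le_trans (p_plus_ge ltr01).
have := p_minus_le ltr01; have := p_minus_ge1; nra.
Qed.

(** Integrated form of t phi(t) <= p^+ Phi(t): the quotient Phi(t) / t^p^+ is
nonincreasing.  Supporting lines of Phi and of t^-p bound its increments, and
their first-order parts cancel. *)
Lemma orlicz_scale_plus k t : 1 <= k -> 0 <= t ->
  Phi (k * t) <= k `^ p_plus Phi * Phi t.
Proof.
move=> k1 t0; have k0 : 0 < k by rewrite (lt_le_trans _ k1).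
have [->|tn] := eqVneq t 0; first by rewrite mulr0 orlicz0 mulr0.
have {tn}t0 : 0 < t by rewrite lt_neqAle eq_sym tn.
set p := p_plus Phi; have p0 : 0 <= p by rewrite (le_trans ler01) ?p_plus_ge1.
pose f s := Phi s * s `^ (- p).
suff : f (k * t) <= f t.
  rewrite /f powRM ?(ltW k0) ?(ltW t0)// mulrA ler_pM2r ?powR_gt0// powRN.
  by rewrite ler_pdivrMr ?powR_gt0// [_ * Phi t]mulrC.
have tkt : t <= k * t by rewrite ler_peMl// ltW.
pose K := p / t * t `^ (- p) * (p * Phi (k * t) / t).
apply: (@quadratic_increment_noninc _ _ _ _ K) => // x y tx xy yk.
have x0 : 0 < x by rewrite (lt_le_trans t0).
have y0 : 0 < y by rewrite (lt_le_trans x0).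
have Py : Phi y - Phi x <= (y - x) * (p * Phi y / y).
  have := orlicz_subgradient (ltW x0) y0; have := p_plus_ge y0.
  rewrite -[y * phi y <= _]ler_pdivlMl// [_^-1 * _]mulrC => H1 H2.
  have : (y - x) * phi y <= (y - x) * (p * Phi y / y).
    by rewrite ler_wpM2l// subr_ge0.
  by lra.
have Px : 0 <= Phi x by rewrite (orlicz_ge0 HPhi) ?ltW.
have tan := powR_tangent p0 y0 x0.
set Y := y `^ (- p) in tan *.
have Yge : 0 <= Y by rewrite powR_ge0.
have -> : f y - f x = Phi y * Y - Phi x * x `^ (- p) by [].
have yx0 : 0 <= y - x by rewrite subr_ge0.
have Pyx : 0 <= Phi y - Phi x by rewrite subr_ge0 orlicz_le// ltW.
(* both first-order terms cancel, which leaves the product of two increments *)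
apply: (@le_trans _ _ ((p / y * Y) * ((y - x) * (Phi y - Phi x)))).
  have := ler_wpM2l Px tan.
  have : Y * (Phi y - Phi x) <= Y * ((y - x) * (p * Phi y / y)).
    exact: ler_wpM2l.
  have -> : Y * ((y - x) * (p * Phi y / y)) = (p / y) * Y * ((y - x) * Phi y).
    by field; rewrite gt_eqF.
  have -> : Phi x * (Y * (1 - p * (x - y) / y)) =
      Phi x * Y + (p / y) * Y * ((y - x) * Phi x).
    by field; rewrite gt_eqF.
  have -> : p / y * Y * ((y - x) * (Phi y - Phi x)) =
      p / y * Y * ((y - x) * Phi y) - p / y * Y * ((y - x) * Phi x).
    by ring.
  by lra.
have ty : t <= y by rewrite (le_trans tx).
have Yt : Y <= t `^ (- p) by exact: ler_powRN.
have pyt : p / y <= p / t by rewrite ler_wpM2l// lef_pV2.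
have step2 : (y - x) * (Phi y - Phi x) <= (y - x) ^+ 2 * (p * Phi (k * t) / t).
  rewrite expr2 -mulrA ler_wpM2l// (le_trans Py)// ler_wpM2l//.
  rewrite -!mulrA ler_wpM2l// ler_pM// ?invr_ge0 ?(orlicz_ge0 HPhi) ?(ltW y0)//.
    by rewrite orlicz_le// ltW.
  by rewrite lef_pV2.
rewrite /K -[leRHS]mulrA [X in _ <= _ * X]mulrC; apply: ler_pM => //.
- by rewrite mulr_ge0// divr_ge0// ltW.
- exact: mulr_ge0.
- by apply: ler_pM => //; rewrite divr_ge0// ltW.
Qed.

(** The mirror image of [orlicz_scale_plus]: the supporting lines are now taken
at the left endpoint. *)
Lemma orlicz_scale_minus k t : 0 <= k -> k <= 1 -> 0 <= t ->
  Phi (k * t) <= k `^ p_minus Phi * Phi t.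
Proof.
move=> k0 k1 t0.
set p := p_minus Phi.
have p1 : 1 <= p by exact: p_minus_ge1.
have p0 : 0 <= p by rewrite (le_trans ler01).
have [->|kn] := eqVneq k 0.
  by rewrite mul0r orlicz0 mulr_ge0 ?powR_ge0 ?(orlicz_ge0 HPhi).
have {kn}k0 : 0 < k by rewrite lt_neqAle eq_sym kn.
have [->|tn] := eqVneq t 0; first by rewrite mulr0 orlicz0 mulr0.
have {tn}t0 : 0 < t by rewrite lt_neqAle eq_sym tn.
pose f s := - (Phi s * s `^ (- p)).
have kt0 : 0 < k * t by rewrite mulr_gt0.
suff : f t <= f (k * t).
  rewrite /f powRM ?(ltW k0) ?(ltW t0)// mulrA lerN2 ler_pM2r ?powR_gt0// powRN.
  by rewrite ler_pdivrMr ?powR_gt0// [_ * Phi t]mulrC.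
have tkt : k * t <= t by rewrite ler_piMl// ltW.
pose u := k * t; rewrite -/u in kt0 tkt *.
pose K := p / u * u `^ (- p) * phi t.
apply: (@quadratic_increment_noninc _ _ _ _ K) => // x y tx xy yk.
have x0 : 0 < x by rewrite (lt_le_trans kt0).
have y0 : 0 < y by rewrite (lt_le_trans x0).
have Py : (y - x) * (p * Phi x / x) <= Phi y - Phi x.
  have := orlicz_subgradient (ltW y0) x0; have := p_minus_le x0.
  rewrite -[_ <= x * phi x]ler_pdivrMl// [_^-1 * _]mulrC => H1 H2.
  have : (y - x) * (p * Phi x / x) <= (y - x) * phi x.
    by rewrite ler_wpM2l// subr_ge0.
  by lra.
have Pyge : 0 <= Phi y by rewrite (orlicz_ge0 HPhi) ?ltW.
have tan := powR_tangent p0 x0 y0.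
set X := x `^ (- p) in tan *.
have Xge : 0 <= X by rewrite powR_ge0.
have -> : f y - f x = Phi x * X - Phi y * y `^ (- p) by rewrite /f -/X; ring.
have yx0 : 0 <= y - x by rewrite subr_ge0.
have Pyx : 0 <= Phi y - Phi x by rewrite subr_ge0 orlicz_le// ltW.
apply: (@le_trans _ _ ((p / x * X) * ((y - x) * (Phi y - Phi x)))).
  have := ler_wpM2l Pyge tan.
  have : X * ((y - x) * (p * Phi x / x)) <= X * (Phi y - Phi x).
    exact: ler_wpM2l.
  have -> : X * ((y - x) * (p * Phi x / x)) = (p / x) * X * ((y - x) * Phi x).
    by field; rewrite gt_eqF.
  have -> : Phi y * (X * (1 - p * (y - x) / x)) =
      Phi y * X - (p / x) * X * ((y - x) * Phi y).
    by field; rewrite gt_eqF.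
  have -> : p / x * X * ((y - x) * (Phi y - Phi x)) =
      p / x * X * ((y - x) * Phi y) - p / x * X * ((y - x) * Phi x).
    by ring.
  by lra.
have Yt : X <= u `^ (- p) by exact: ler_powRN.
have pyt : p / x <= p / u by rewrite ler_wpM2l// lef_pV2.
have Pt : Phi y - Phi x <= (y - x) * phi t.
  (* the slope is bounded by its value at the right end, since slopes increase *)
  have H1 : (y - x) * phi y <= (y - x) * phi t.
    rewrite ler_wpM2l//; have [->//|yt] := eqVneq y t.
    have {}yt : y < t by rewrite lt_neqAle yt.
    have t_y : 0 < t - y by rewrite subr_gt0.
    have := orlicz_subgradient (ltW t0) y0.
    have := orlicz_subgradient (ltW y0) t0.
    by rewrite -(ler_pM2l t_y); lra.
  by have := orlicz_subgradient (ltW x0) y0; lra.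
have step2 : (y - x) * (Phi y - Phi x) <= (y - x) ^+ 2 * phi t.
  by rewrite expr2 -mulrA ler_wpM2l.
rewrite /K -[leRHS]mulrA [X in _ <= _ * X]mulrC; apply: ler_pM => //.
- by rewrite mulr_ge0// divr_ge0// ltW.
- exact: mulr_ge0.
- by apply: ler_pM => //; rewrite divr_ge0// ltW.
Qed.

(** If p^+ were 1, then Phi(t) / t would be bounded. *)
Lemma p_plus_gt1 : 1 < p_plus Phi.
Proof.
rewrite ltNge; apply/negP => p1.
have H t : 1 <= t -> Phi t <= t * Phi 1.
  move=> t1; have t0 : 0 <= t by rewrite (le_trans ler01).
  have := orlicz_scale_plus t1 ler01; rewrite mulr1 => /le_trans; apply.
  rewrite ler_wpM2r ?(orlicz_ge0 HPhi)//.
  by rewrite -[leRHS]powRr1// ler_powR.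
have := orlicz_cvgy HPhi => /cvgryPge/(_ (Phi 1 + 1)) [M [Mr HM]].
have := HM (Num.max (M + 1) 1).
have ->/= : (M < Num.max (M + 1) 1) by rewrite lt_max ltrDl ltr01.
set t := Num.max _ _ => /(_ isT).
have t1 : 1 <= t by rewrite le_max lexx orbT.
have t0 : 0 < t by rewrite (lt_le_trans _ t1).
rewrite ler_pdivlMr//; have := H t t1; nra.
Qed.

(** Quantitative quasi-additivity: the factor in front of Phi(a) is as close
to 1 as wanted, and the price is only eps^(1 - p^+), one power better than
what the convexity inequality gives.  The gain comes from estimating the
increment Phi(a + b) - Phi(a) by b phi(a + b). *)
Lemma orlicz_add a b e : 0 <= a -> 0 <= b -> 0 < e -> e <= 1 ->
  Phi (a + b) <= (1 + p_plus Phi * 2 `^ p_plus Phi * e) * Phi a +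
                 p_plus Phi * 2 `^ p_plus Phi * e `^ (1 - p_plus Phi) * Phi b.
Proof.
move=> a0 b0 e0 e1; set p := p_plus Phi; set C := p * 2 `^ p.
have p1 : 1 <= p by exact: p_plus_ge1.
have p0 : 0 <= p by rewrite (le_trans ler01).
have C0 : 0 <= C by rewrite mulr_ge0 ?powR_ge0.
have Pa := orlicz_ge0 HPhi a0; have Pb := orlicz_ge0 HPhi b0.
have ab0 : 0 <= a + b by rewrite addr_ge0.
have [ab|abn] := eqVneq (a + b) 0.
  rewrite ab orlicz0 addr_ge0// mulr_ge0 ?powR_ge0//.
    by rewrite addr_ge0// mulr_ge0// ltW.
  by rewrite mulr_ge0 ?powR_ge0.
have {}ab0 : 0 < a + b by rewrite lt_neqAle eq_sym abn.
have incr : Phi (a + b) <= Phi a + p * (b / (a + b) * Phi (a + b)).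
  have := orlicz_subgradient a0 ab0; have := p_plus_ge ab0.
  rewrite -/p -[X in is_true X -> _]ler_pdivlMl// => H1 H2.
  have H3 := ler_wpM2l b0 H1.
  have -> : p * (b / (a + b) * Phi (a + b)) = b * ((a + b)^-1 * (p * Phi (a + b))).
    by field; rewrite gt_eqF.
  by have := H2; rewrite opprD addrA subrr sub0r mulNr; lra.
have [be|be] := leP b (e * a).
  suff : p * (b / (a + b) * Phi (a + b)) <= C * e * Phi a.
    by have := mulr_ge0 (mulr_ge0 C0 (powR_ge0 e (1 - p))) Pb; nra.
  rewrite /C -!mulrA ler_wpM2l// mulrA [2 `^ p * _]mulrCA.
  have b_ab : b / (a + b) <= e.
    by rewrite ler_pdivrMr// mulrDr (le_trans be)// lerDl mulr_ge0// ltW.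
  apply: ler_pM => //; first by rewrite divr_ge0// ltW.
    by rewrite (orlicz_ge0 HPhi)// ltW.
  apply: le_trans (orlicz_scale_plus _ a0); last by rewrite ler1n.
  by apply: orlicz_le; [exact: ltW|nra].
suff : p * (b / (a + b) * Phi (a + b)) <= C * e `^ (1 - p) * Phi b.
  by have := mulr_ge0 (mulr_ge0 C0 (ltW e0)) Pa; nra.
rewrite /C -!mulrA ler_wpM2l//.
have b1 : 0 < b by nra.
have k1 : 1 <= 2 / e by rewrite ler_pdivlMr// mul1r; lra.
have k0 : 0 < 2 / e by rewrite (lt_le_trans _ k1).
have abk : a + b <= 2 / e * b.
  by rewrite mulrAC ler_pdivlMr//; nra.
have := orlicz_ratio (ltW ab0) abk (lt_le_trans ab0 abk).
have := orlicz_scale_plus k1 b0; rewrite -/p => H1 H2.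
apply: (@le_trans _ _ (b / (a + b) * ((a + b) / (2 / e * b) * ((2 / e) `^ p * Phi b)))).
  rewrite mulrA ler_wpM2l ?divr_ge0 ?(ltW ab0)//.
  apply: (le_trans H2); rewrite ler_wpM2l// divr_ge0 ?(ltW ab0)//.
  by rewrite mulr_ge0// ltW.
rewrite powRM ?invr_ge0 ?(ltW e0)// -[e^-1 in X in X <= _]powR_inv1 ?(ltW e0)//.
have -> : (e `^ (-1)) `^ p = e `^ (1 - p) / e.
  rewrite -powRrM mulN1r powRD ?(gt_eqF e0) ?implybT// powRr1 ?ltW//.
  by rewrite mulrAC divff ?gt_eqF// mul1r.
rewrite powR_inv1 ?(ltW e0)//.
set T := 2 `^ p; set E := e `^ _.
have TE : 0 <= T * (E * Phi b).
  by rewrite mulr_ge0 ?powR_ge0// mulr_ge0 ?powR_ge0.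
have -> : b / (a + b) * ((a + b) / (2 / e * b) * (T * (E / e) * Phi b)) =
    2^-1 * (T * (E * Phi b)).
  by field; rewrite !gt_eqF.
by lra.
Qed.

End orlicz_theory.

(** * Borel sets, the Euclidean norm and dilations of R^n *)

Section borel_rV.
Context {R : realType} {N : nat}.
Implicit Types (f : 'rV[R]_N -> R) (U : set 'rV[R]_N).

(** An open set is the union of the countably many rational cubes inside it. *)
Lemma open_measurable_rV U : open U -> measurable (U : set 'rV[measurableTypeR R]_N).
Proof.
move=> oU.
pose cube (q : 'rV[rat]_N * rat) : set 'rV[R]_N :=
  [set v | forall i, ball (ratr (q.1 ord0 i) : R) (ratr q.2) (v ord0 i)].
pose I : set ('rV[rat]_N * rat) := [set q | cube q `<=` U].
have -> : U = \bigcup_q (if q \in I then cube q else set0).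
  apply/seteqP; split => [v Uv|v [q _]]; last by case: ifPn => // /set_mem; apply.
  have /nbhs_ballP[e /= e0 eU] : nbhs v U by exact: open_nbhs_nbhs.
  have [r] := @rat_in_itvoo R 0 (e / 2) ltac:(lra); rewrite in_itv/= => /andP[r0 re].
  have cq i : exists s : rat, ratr s \in `](v ord0 i - ratr r), (v ord0 i + ratr r)[.
    by apply: rat_in_itvoo; lra.
  pose q := \row_i xchoose (cq i).
  have qv i : `|ratr (q ord0 i) - v ord0 i| < ratr r.
    rewrite mxE; have := xchooseP (cq i); rewrite in_itv/= => /andP[].
    by rewrite ltr_norml; lra.
  exists (q, r) => //; rewrite mem_set/=; first by move=> i; exact: qv.
  move=> w /= qw; apply: eU; split => // i j; rewrite (ord1 i).
  rewrite /ball/= (le_lt_trans (ler_distD (ratr (q ord0 j)) _ _))//.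
  by rewrite distrC; have := qw j; rewrite /ball/=; have := qv j; lra.
apply: countable_bigcupT_measurable; first exact: countableP.
move=> q; case: ifPn => // _.
have -> : cube q = \bigcap_(i in [set: 'I_N])
  ((fun v : 'rV[measurableTypeR R]_N => v ord0 i) @^-1` ball (ratr (q.1 ord0 i) : R) (ratr q.2)).
  by apply/seteqP; split => [v cv i _|v cv i]; [exact: cv|exact: cv].
apply: fin_bigcap_measurable => [|i _]; first exact: finite_finset.
rewrite -[X in measurable X]setTI; apply: measurable_coord => //.
exact: measurable_ball.
Qed.

Lemma continuous_measurable_rV f : continuous f ->
  measurable_fun [set: 'rV[measurableTypeR R]_N] f.
Proof.
move=> /continuousP cf.
apply: (measurability _ (RGenOInfty.measurableE R)) => _ [_ [a ->] <-].
rewrite setTI; apply: open_measurable_rV; apply: cf; exact: interval_open.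
Qed.

Lemma measurable_fun_scale_rV : measurable_fun
  [set: measurableTypeR R * 'rV[measurableTypeR R]_N] (fun p => (p.1 : R) *: p.2).
Proof.
apply: measurable_fun_rVP => i.
under eq_fun do rewrite mxE.
apply: measurable_funM => //.
exact: (measurableT_comp (measurable_coord i) measurable_snd).
Qed.

Lemma enorm_ge0 (x : 'rV[R]_N) : 0 <= enorm x.
Proof. exact: sqrtr_ge0. Qed.

Lemma enormZ (s : R) (x : 'rV[R]_N) : enorm (s *: x) = `|s| * enorm x.
Proof.
rewrite /enorm; under eq_bigr do rewrite mxE exprMn.
by rewrite -mulr_sumr sqrtrM ?sqr_ge0// sqrtr_sqr.
Qed.

Lemma coord_le_enorm (x : 'rV[R]_N) i : `|x ord0 i| <= enorm x.
Proof.
rewrite -sqrtr_sqr ler_wsqrtr// (bigD1 i)//= lerDl sumr_ge0// => j _.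
exact: sqr_ge0.
Qed.

Lemma enorm0 : enorm (0 : 'rV[R]_N) = 0.
Proof.
by rewrite /enorm big1 ?sqrtr0// => i _; rewrite mxE expr0n.
Qed.

Lemma enorm_eq0 (x : 'rV[R]_N) : (enorm x == 0) = (x == 0).
Proof.
apply/eqP/eqP => [x0|->]; last exact: enorm0.
apply/rowP => i; rewrite mxE; apply/eqP.
by rewrite -normr_le0 -x0 coord_le_enorm.
Qed.

Lemma enorm_gt0 (x : 'rV[R]_N) : (0 < enorm x) = (x != 0).
Proof. by rewrite lt_neqAle enorm_ge0 andbT eq_sym enorm_eq0. Qed.

Lemma enorm_continuous : continuous (@enorm R N).
Proof.
have csum : continuous (fun x : 'rV[R]_N => \sum_(i < N) x ord0 i ^+ 2).
  apply: continuous_big => [|i _ x]; first exact: add_continuous.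
  by apply: continuousM; exact: coord_continuous.
by move=> x; apply: continuous_comp; [exact: csum|exact: sqrt_continuous].
Qed.

Lemma measurable_enorm : measurable_fun [set: 'rV[measurableTypeR R]_N] (@enorm R N).
Proof. exact: continuous_measurable_rV enorm_continuous. Qed.

Lemma measurable_enorm_ge (e : R) :
  measurable ([set x | e <= enorm x] : set 'rV[measurableTypeR R]_N).
Proof.
rewrite -[X in measurable X]setTI.
have -> : [set x : 'rV[R]_N | e <= enorm x] = (@enorm R N) @^-1` `[e, +oo[.
  by apply/seteqP; split => x /=; rewrite in_itv/= andbT.
exact: measurable_enorm.
Qed.

Lemma measurable_eball (e : R) :
  measurable (eball e : set 'rV[measurableTypeR R]_N).
Proof.
have -> : eball e = ~` [set x : 'rV[R]_N | e <= enorm x].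
  by apply/seteqP; split => x /=; rewrite /eball/= ltNge => /negP.
by apply: measurableC; exact: measurable_enorm_ge.
Qed.

Lemma measurable_scalel_rV (s : R) : measurable_fun setT
  ((fun x => s *: x) : 'rV[measurableTypeR R]_N -> 'rV[measurableTypeR R]_N).
Proof.
apply: measurable_fun_rVP => i; under eq_fun do rewrite mxE.
by apply: measurable_funM => //; exact: measurable_coord.
Qed.

End borel_rV.

Section lebesgue_scaling.
Context {R : realType}.
Local Open Scope ereal_scope.

(** Both sides are measures in A that agree on intervals. *)
Lemma lebesgue_measure_scale (s : R) (A : set (measurableTypeR R)) :
  (0 < s)%R -> measurable A ->
  lebesgue_measure ((fun x : R => s * x)%R @^-1` A) = s^-1%:E * lebesgue_measure A.
Proof.
move=> s0 mA.
have ms : measurable_fun setT ((fun x : R => s * x)%R : measurableTypeR R -> measurableTypeR R).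
  exact: mulrl_measurable.
pose phi : measurableTypeR R -> measurableTypeR R := (fun x : R => s * x)%R.
pose m := mscale (NngNum (ltW s0)) (pushforward (@lebesgue_measure R) phi).
have -> : lebesgue_measure A = m ms A.
  apply: lebesgue_measure_unique => //= _ [[a b]] _ <-.
  rewrite /m /mscale /pushforward/=.
  have -> : pushforward (@lebesgue_measure R) phi `]a, b]%classic =
      lebesgue_measure `](a / s)%R, (b / s)%R]%classic.
    by congr lebesgue_measure; apply/seteqP; split => x /=;
      rewrite !in_itv/= ltr_pdivrMr// ler_pdivlMr// mulrC.
  rewrite !lebesgue_measure_itv/= !lte_fin ltr_pM2r ?invr_gt0//.
  case: ifPn => _; last by rewrite mule0.
  by rewrite -!EFinD -EFinM mulrBr; congr EFin; field; rewrite gt_eqF.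
rewrite /m /mscale /pushforward/= muleA -EFinM mulVf ?mul1e//.
by rewrite gt_eqF.
Qed.

Lemma ge0_integral_scale (s : R) (F : measurableTypeR R -> \bar R) :
  (0 < s)%R -> measurable_fun setT F -> (forall x, 0 <= F x) ->
  \int[lebesgue_measure]_x F (s * x)%R = s^-1%:E * \int[lebesgue_measure]_x F x.
Proof.
move=> s0 mF F0.
have ms : measurable_fun setT ((fun x : R => s * x)%R : measurableTypeR R -> measurableTypeR R).
  exact: mulrl_measurable.
have := @ge0_integral_pushforward _ _ _ _ R _ ms lebesgue_measure setT F
  measurableT mF (fun x _ => F0 x).
rewrite preimage_setT => <-.
have s0' : (0 <= s^-1)%R by rewrite invr_ge0 ltW.
rewrite -(@ge0_integral_mscale _ _ R lebesgue_measure setT measurableT (NngNum s0'))//.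
by apply: eq_measure_integral => A mA _; exact: lebesgue_measure_scale.
Qed.

Lemma integral_rV_succ n (F : 'rV[R]_n.+1 -> \bar R) :
  measurable_fun setT F -> (forall x, 0 <= F x) ->
  \int[lebesgue_rV n.+1]_x F x =
  \int[lebesgue_measure]_a \int[lebesgue_rV n]_v F (rV_cons (a, v)).
Proof.
move=> mF F0.
have mc := @measurable_rV_cons R n.
have := @ge0_integral_pushforward _ _ _ _ R _ mc
  (lebesgue_measure \x lebesgue_rV n) setT F measurableT mF (fun x _ => F0 x).
rewrite preimage_setT => /= ->.
rewrite (fubini_tonelli1 (F \o @rV_cons R n))//; first exact: measurableT_comp.
by move=> x; exact: F0.
Qed.

(** The measure on R^(n+1) is the image of a product, so by Fubini's theorem
each coordinate contributes one factor s^-1. *)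
Lemma integral_rV_scale n (s : R) (F : 'rV[R]_n -> \bar R) :
  (0 < s)%R -> measurable_fun setT F -> (forall x, 0 <= F x) ->
  \int[lebesgue_rV n]_x F (s *: x)%R = (s^-1 ^+ n)%:E * \int[lebesgue_rV n]_x F x.
Proof.
move=> s0; have si0 : (0 <= s^-1)%R by rewrite invr_ge0 ltW.
elim: n F => [|n IHn] F mF F0.
  rewrite expr0 mul1e; apply: eq_integral => x _; congr F.
  by apply/rowP => -[].
have mFS : measurable_fun setT (fun x : 'rV[R]_n.+1 => F (s *: x)%R).
  exact: (measurableT_comp mF (measurable_scalel_rV s)).
rewrite !integral_rV_succ//.
pose K (a : measurableTypeR R) := \int[lebesgue_rV n]_v F (rV_cons (a, v)).
have mFc : measurable_fun setT (F \o @rV_cons R n).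
  apply: measurableT_comp => //; exact: measurable_rV_cons.
have mK : measurable_fun setT K.
  by apply: (measurable_fun_fubini_tonelli_F (F \o @rV_cons R n)) => // x; exact: F0.
have K0 a : 0 <= K a by exact: integral_ge0.
transitivity (\int[lebesgue_measure]_a ((s^-1 ^+ n)%:E * K (s * a)%R)).
  apply: eq_integral => a _.
  rewrite /K -IHn//; last by exact: (measurableT_comp mFc (pair1_measurable _)).
  apply: eq_integral => v _; congr F; apply/rowP => i; rewrite mxE.
  have [j ->|->] := unliftP ord0 i; last by rewrite !rV_cons0.
  by rewrite !rV_consS/= mxE.
rewrite ge0_integralZl_EFin//; last 2 first.
- by apply: (measurableT_comp mK); exact: mulrl_measurable.
- by rewrite exprn_ge0.
by rewrite ge0_integral_scale// muleA -EFinM -exprSr.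
Qed.

End lebesgue_scaling.

(** * Dilations under the integral *)

Section lebesgue_rV_lemmas.
Context {R : realType}.
Local Open Scope ereal_scope.

Lemma lebesgue_rV_point0 N : (0 < N)%N -> lebesgue_rV N [set (0%R : 'rV[R]_N)] = 0.
Proof.
case: N => // n _.
have -> : [set (0%R : 'rV[R]_n.+1)] =
    [set v : 'rV[R]_n.+1 | forall i, [set (0%R : measurableTypeR R)] (v ord0 i)].
  apply/seteqP; split => [v -> i|v v0]; first by rewrite /= mxE.
  by apply/rowP => i; rewrite (v0 i) mxE.
rewrite (@lebesgue_rV_box _ _ (fun=> [set (0%R : measurableTypeR R)]))//=.
by rewrite big_ord_recl lebesgue_measure_set1 mul0e.
Qed.

Definition cube N (a b : R) : set 'rV[R]_N :=
  [set v | forall i, `[a, b[%classic (v ord0 i)].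

Lemma measurable_cube N (a b : R) :
  measurable (cube a b : set 'rV[measurableTypeR R]_N).
Proof.
have -> : (cube a b : set 'rV[measurableTypeR R]_N) =
  \bigcap_(i in [set: 'I_N])
    ((fun v : 'rV[measurableTypeR R]_N => v ord0 i) @^-1` `[a, b[%classic).
  by apply/seteqP; split => [v cv i _|v cv i]; [exact: cv|exact: cv].
apply: fin_bigcap_measurable => [|i _]; first exact: finite_finset.
by rewrite -[X in measurable X]setTI; apply: measurable_coord.
Qed.

Lemma lebesgue_rV_cube N (a b : R) : (a <= b)%R ->
  lebesgue_rV N (cube a b) = ((b - a) ^+ N)%:E.
Proof.
move=> ab; rewrite (@lebesgue_rV_box _ _ (fun=> `[a, b[%classic))//.
rewrite (eq_bigr (fun=> (b - a)%:E)) => [|i _]; last first.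
  rewrite lebesgue_measure_itv/= lte_fin lt_neqAle ab andbT.
  by case: eqVneq => [->|_] //=; rewrite subrr.
by rewrite prodEFin prodr_const card_ord.
Qed.

Lemma integral_cube_cst N (a b B : R) : (a <= b)%R ->
  \int[lebesgue_rV N]_(x in cube a b) (cst B%:E) x = (B * (b - a) ^+ N)%:E.
Proof.
move=> ab; pose Q : set 'rV[measurableTypeR R]_N := cube a b.
have mQ : measurable Q by exact: measurable_cube.
have muQ : lebesgue_rV N Q = _ := @lebesgue_rV_cube N a b ab.
have -> : \int[lebesgue_rV N]_(x in Q) (cst B%:E) x = B%:E * lebesgue_rV N Q.
  by rewrite integral_cst.
by rewrite muQ EFinM.
Qed.

Lemma integral_bounded_lty N (f : 'rV[R]_N -> R) (B M : R) :
  measurable_fun [set: 'rV[measurableTypeR R]_N] f -> (forall x, 0 <= f x <= B)%R ->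
  (forall x, f x != 0 -> enorm x <= M)%R ->
  \int[lebesgue_rV N]_x (f x)%:E < +oo.
Proof.
move=> mf fB fM.
pose Q : set 'rV[measurableTypeR R]_N := cube (- (`|M| + 1)) (`|M| + 1).
have mQ : measurable Q by exact: measurable_cube.
have B0 : (0 <= B)%R by have /andP[] := fB 0%R; exact: le_trans.
apply: (@le_lt_trans _ _ (\int[lebesgue_rV N]_(x in Q) (cst B%:E) x)).
  rewrite [leRHS]integral_mkcond; apply: ge0_le_integral => //.
  - by move=> x _; rewrite lee_fin; have /andP[] := fB x.
  - exact/measurable_EFinP.
  - by apply/(measurable_restrictT _ mQ); exact: measurable_cst.
  move=> x _; rewrite patchE; case: ifPn => [_|xQ].
    by rewrite lee_fin; have /andP[] := fB x.
  rewrite lee_fin; have [->//|/fM xM] := eqVneq (f x) 0%R.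
  move: xQ; rewrite notin_setE => -[]; move=> i /=.
  have := le_trans (coord_le_enorm x i) (le_trans xM (ler_norm M)).
  rewrite in_itv/= ler_norml => /andP[h1 h2].
  by apply/andP; split; lra.
have M0 := normr_ge0 M.
by rewrite integral_cube_cst ?ltry//; lra.
Qed.

(** The origin is a null set; the shells make the rest accessible to monotone
convergence. *)
Lemma integral_eq_compl0 N (f : 'rV[R]_N -> \bar R) : (0 < N)%N ->
  measurable_fun [set: 'rV[measurableTypeR R]_N] f -> (forall x, 0 <= f x) ->
  \int[lebesgue_rV N]_x f x =
  \int[lebesgue_rV N]_(x in \bigcup_k [set x | k.+1%:R^-1 <= enorm x]%R) f x.
Proof.
move=> N0 mf f0.
have m0 : measurable ([set 0%R] : set 'rV[measurableTypeR R]_N).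
  have -> : [set (0%R : 'rV[R]_N)] = \bigcap_k eball (k.+1%:R^-1).
    apply/seteqP; split => [x -> k _|x xk]; first by rewrite /eball/= enorm0.
    apply/eqP; rewrite -enorm_eq0 eq_le enorm_ge0 andbT leNgt; apply/negP => e0.
    have [k] := ltr_add_invr e0; rewrite add0r => /ltW ke.
    by have := xk k I; rewrite /eball/= ltNge ke.
  by apply: bigcap_measurable => // k _; exact: measurable_eball.
rewrite (@ge0_negligible_integral _ _ _ (lebesgue_rV N) setT [set (0%R : 'rV[R]_N)])//; last first.
  exact: lebesgue_rV_point0.
congr integral; apply/seteqP; split => [x /= [_ /eqP x0]|x [k _ /= xk]].
  have : (0 < enorm x)%R by rewrite enorm_gt0.
  by move=> /ltr_add_invr[k]; rewrite add0r => /ltW xk; exists k.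
by split => //= x0; move: xk; rewrite x0 enorm0 leNgt invr_gt0 ltr0n.
Qed.

(** The substitute for integrating along rays.  The change of variables by lam
turns the pointwise bound of P by Q(lam .) into a bound of the integral of P by
that of Q, and the deficit Z of Q with respect to P is then controlled by H.
The subtraction is legitimate because P is integrable. *)
Lemma dilation_absorption N (lam : R) (P Q Z : 'rV[R]_N -> R) (H : 'rV[R]_N -> \bar R) :
  (0 < lam)%R ->
  measurable_fun [set: 'rV[measurableTypeR R]_N] P ->
  measurable_fun [set: 'rV[measurableTypeR R]_N] Q ->
  measurable_fun [set: 'rV[measurableTypeR R]_N] Z ->
  measurable_fun [set: 'rV[measurableTypeR R]_N] H ->
  (forall x, 0 <= P x)%R -> (forall x, 0 <= Q x)%R -> (forall x, 0 <= Z x)%R ->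
  (forall x, 0 <= H x) ->
  (forall x, (P x)%:E <= (Q (lam *: x)%R)%:E + H x) ->
  (forall x, lam^-1 ^+ N * Q x + Z x <= P x)%R ->
  \int[lebesgue_rV N]_x (P x)%:E < +oo ->
  \int[lebesgue_rV N]_x (Z x)%:E <= \int[lebesgue_rV N]_x H x.
Proof.
move=> l0 mP mQ mZ mH P0 Q0 Z0 H0 PQ QZ Poo.
have lN : (0 <= lam^-1 ^+ N)%R by rewrite exprn_ge0// invr_ge0 ltW.
have mS := @measurable_scalel_rV R N lam.
have E1 : \int[lebesgue_rV N]_x (P x)%:E <=
    \int[lebesgue_rV N]_x (lam^-1 ^+ N * Q x)%:E + \int[lebesgue_rV N]_x H x.
  under [X in _ <= X + _]eq_integral do rewrite EFinM.
  rewrite ge0_integralZl_EFin//; last 2 first.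
  - by move=> x _; rewrite lee_fin.
  - exact/measurable_EFinP.
  rewrite -(@integral_rV_scale _ _ _ (fun x => (Q x)%:E))//; last first.
    exact/measurable_EFinP.
  rewrite -ge0_integralD//; last 2 first.
  - by move=> x _; rewrite lee_fin.
  - by apply/measurable_EFinP; exact: (measurableT_comp mQ mS).
  apply: ge0_le_integral => //.
  - by move=> x _; rewrite lee_fin.
  - exact/measurable_EFinP.
  - apply: emeasurable_funD => //; apply/measurable_EFinP.
    exact: (measurableT_comp mQ mS).
have E2 : \int[lebesgue_rV N]_x (lam^-1 ^+ N * Q x)%:E +
    \int[lebesgue_rV N]_x (Z x)%:E <= \int[lebesgue_rV N]_x (P x)%:E.
  rewrite -ge0_integralD//; last 4 first.
  - by move=> x _; rewrite lee_fin mulr_ge0.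
  - by apply/measurable_EFinP; exact: measurable_funM.
  - by move=> x _; rewrite lee_fin.
  - exact/measurable_EFinP.
  apply: ge0_le_integral => //.
  - by move=> x _; rewrite -EFinD lee_fin addr_ge0// mulr_ge0.
  - apply: emeasurable_funD; apply/measurable_EFinP => //.
    exact: measurable_funM.
  - exact/measurable_EFinP.
  by move=> x _; rewrite -EFinD lee_fin.
rewrite -(@leeD2lE _ (\int[lebesgue_rV N]_x (lam^-1 ^+ N * Q x)%:E)).
  exact: le_trans E2 E1.
rewrite ge0_fin_numE; last first.
  by apply: integral_ge0 => x _; rewrite lee_fin mulr_ge0.
apply: le_lt_trans Poo; apply: le_trans E2; rewrite leeDl//.
by apply: integral_ge0 => x _; rewrite lee_fin.
Qed.

(** The parameter runs over [0, 1], of measure 1, so that Jensen's inequality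
applies without normalization. *)
Definition segment_average N (lam : R) (F : 'rV[R]_N -> \bar R) (x : 'rV[R]_N) :=
  \int[lebesgue_measure]_(t in `[0%R, 1%R]) F ((1 + t * (lam - 1)) *: x)%R.

Section segment_average.
Context {N : nat} (lam : R) (F : 'rV[R]_N -> \bar R).
Hypothesis lam_bnd : (2^-1 <= lam <= 2)%R.
Hypothesis mF : measurable_fun [set: 'rV[measurableTypeR R]_N] F.
Hypothesis F0 : forall x, 0 <= F x.

Let D := `[0%R, 1%R]%classic : set (measurableTypeR R).
Let s (t : R) := (1 + t * (lam - 1))%R.
Let TD : set ('rV[measurableTypeR R]_N * measurableTypeR R) := setT `*` D.
Let G := (fun p : 'rV[measurableTypeR R]_N * measurableTypeR R => F (s p.2 *: p.1)%R) \_ TD.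

Let mD : measurable D. Proof. exact: measurable_itv. Qed.

Let mTD : measurable TD. Proof. exact: measurableX. Qed.

Let mG : measurable_fun setT G.
Proof.
apply/(measurable_restrictT _ mTD).
apply: measurable_funS measurableT _ _ => //.
have msnd : measurable_fun setT
    (fun p : 'rV[measurableTypeR R]_N * measurableTypeR R => (s p.2, p.1)).
  apply/measurable_fun_pairP; split; last exact: measurable_fst.
  by apply: measurable_funD => //; apply: measurable_funM.
apply: (measurableT_comp mF).
exact: (measurableT_comp (@measurable_fun_scale_rV R N) msnd).
Qed.

Let G0 p : 0 <= G p.
Proof. by rewrite /G patchE; case: ifPn. Qed.

Let segment_averageE x : segment_average lam F x = \int[lebesgue_measure]_t G (x, t).
Proof.
rewrite /segment_average integral_mkcond; apply: eq_integral => t _.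
by rewrite /G !patchE in_setX in_setT.
Qed.

Lemma measurable_segment_average :
  measurable_fun [set: 'rV[measurableTypeR R]_N] (segment_average lam F).
Proof.
rewrite (_ : segment_average lam F = fun x => \int[lebesgue_measure]_t G (x, t)).
  exact: measurable_fun_fubini_tonelli_F.
by apply/funext => x; exact: segment_averageE.
Qed.

Lemma segment_average_ge0 x : 0 <= segment_average lam F x.
Proof. exact: integral_ge0. Qed.

(** Every point of the segment is a dilate of x by a factor s >= 1/2, and the
dilation changes the integral by s^-N <= 2^N. *)
Lemma integral_segment_average :
  \int[lebesgue_rV N]_x segment_average lam F x <= (2 ^+ N)%:E * \int[lebesgue_rV N]_x F x.
Proof.
under eq_integral do rewrite segment_averageE.
rewrite (fubini_tonelli (m1 := lebesgue_rV N) (m2 := lebesgue_measure) G)//.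
set I := \int[_]_x F x.
have I0 : 0 <= I by exact: integral_ge0.
have J0 : 0 <= (2 ^+ N)%:E * I by rewrite mule_ge0// lee_fin exprn_ge0.
apply: (@le_trans _ _ (\int[lebesgue_measure]_(t in D) cst ((2 ^+ N)%:E * I) t)).
  rewrite [leRHS]integral_mkcond; apply: ge0_le_integral => //.
  - by move=> t _; exact: integral_ge0.
  - exact: measurable_fun_fubini_tonelli_G.
  - by apply/(measurable_restrictT _ mD); exact: measurable_cst.
  move=> t _; rewrite patchE; case: ifPn => tD; last first.
    rewrite integral0_eq// => x _.
    by rewrite /G patchE in_setX in_setT (negbTE tD).
  have : D t := set_mem tD; rewrite /D/= in_itv/= => /andP[t0 t1].
  have st : (2^-1 <= s t)%R.
    by case/andP: lam_bnd => l1 l2; rewrite /s; nra.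
  have s0 : (0 < s t)%R by lra.
  rewrite (eq_integral (fun x : 'rV[R]_N => F (s t *: x)%R)); last first.
    by move=> x _; rewrite /G patchE in_setX in_setT tD.
  rewrite integral_rV_scale// lee_wpmul2r// lee_fin.
  rewrite lerXn2r ?nnegrE ?invr_ge0 ?(ltW s0)//.
  by rewrite -[leRHS]invrK lef_pV2// posrE invr_gt0.
rewrite integral_cst//= lebesgue_measure_itv/= lte_fin ltr01 oppr0 adde0 mule1.
exact: lexx.
Qed.

End segment_average.

End lebesgue_rV_lemmas.

(** * Test functions *)

Section test_functions.
Context {R : realType} {N : nat}.
Implicit Types (u : 'rV[R]_N -> R) (x y v : 'rV[R]_N).

(** What the estimates use of a compactly supported C^1 function, whether its
domain is the whole space or the space without the origin. *)
Record test_function u : Prop := TestFunction {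
  test_continuous : continuous u ;
  test_grad_continuous : continuous (grad u) ;
  test_differentiable : forall x, x != 0 -> differentiable u x ;
  test_support : exists M, forall x, u x != 0 -> enorm x <= M ;
  test_bounded : exists B, forall x, `|u x| <= B }.

Lemma subset_supp u x : u x != 0 -> supp u x.
Proof. by move=> ux; apply: (@subset_closure _ [set x | u x != 0]). Qed.

Lemma near_notin_supp u x : ~ supp u x -> \near x, u x = 0.
Proof.
move=> nx; have oS : open (~` supp u) by exact/closed_openC/closed_closure.
have := open_nbhs_nbhs (conj oS nx); apply: filterS => y ny.
by apply/eqP; apply: contrapT => /negP uy; apply: ny; exact: subset_supp.
Qed.

Lemma grad_eq0 u x : (\near x, u x = 0) -> grad u x = 0.
Proof.
move=> ux; apply/rowP => i; rewrite !mxE.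
by rewrite (@near_eq_derive _ _ _ u (cst 0))// derive_cst.
Qed.

Lemma compact_bound (f : 'rV[R]_N -> R) (A : set 'rV[R]_N) :
  continuous f -> compact A -> exists M, forall x, A x -> `|f x| <= M.
Proof.
move=> cf cA; have cfA : {within A, continuous f} by exact: continuous_subspaceT.
have /compact_bounded[M [_ HM]] := continuous_compact cfA cA.
exists (M + 1) => x Ax; apply: (HM (M + 1)); first by rewrite ltrDl.
by exists x.
Qed.

Lemma test_function_bounds u : continuous u -> compact (supp u) ->
  (exists M, forall x, u x != 0 -> enorm x <= M) /\
  (exists B, forall x, `|u x| <= B).
Proof.
move=> cu cS; split.
  have [M HM] := compact_bound (@enorm_continuous R N) cS.
  exists M => x ux; rewrite (le_trans (ler_norm _))// HM//.
  exact: subset_supp.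
have [B HB] := compact_bound cu cS; exists `|B| => x.
have [->|ux] := eqVneq (u x) 0; first by rewrite normr0.
by rewrite (le_trans (HB _ _)) ?ler_norm//; exact: subset_supp.
Qed.

Lemma C1c_test_function u : C1c setT u -> test_function u.
Proof.
move=> [du cS _].
have cu : continuous u.
  by move=> x; apply: differentiable_continuous; exact: (du x I).1.
have [H1 H2] := test_function_bounds cu cS.
by split => // x; [exact: (du x I).2|move=> _; exact: (du x I).1].
Qed.

Lemma enorm_le_mx_norm (e : R) x : 0 < e -> enorm x < e -> ball (0 : 'rV[R]_N) e x.
Proof.
move=> e0 xe; split => // i j; rewrite (ord1 i) mxE /ball/= sub0r normrN.
exact: le_lt_trans (coord_le_enorm _ _) xe.
Qed.

Lemma C1c_punctured_test_function u : C1c (~` [set 0]) u ->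
  test_function u /\ exists2 e, 0 < e & forall x, enorm x < e -> u x = 0.
Proof.
move=> [du cS S0].
have n0 : ~ supp u 0 by move=> /S0; exact.
have nu0 := near_notin_supp n0.
have cu : continuous u.
  move=> x; have [->|x0] := eqVneq x 0.
    rewrite /continuous_at (nbhs_singleton nu0) => A /nbhs_singleton A0.
    by apply: filterS nu0 => y /= ->.
  by apply: differentiable_continuous; apply: (du x _).1; exact/eqP.
have cg : continuous (grad u).
  move=> x; have [->|x0] := eqVneq x 0; last by apply: (du x _).2; exact/eqP.
  rewrite /continuous_at (grad_eq0 nu0) => A /nbhs_singleton A0.
  by have := near_join nu0; apply: filterS => y /= /grad_eq0 ->.
have [H1 H2] := test_function_bounds cu cS.
split; first by split => // x x0; apply: (du x _).1; exact/eqP.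
have /nbhs_ballP[e /= e0 He] := nu0; exists e => // x xe.
by apply: He; exact: enorm_le_mx_norm.
Qed.

Lemma derive_grad u x v : differentiable u x ->
  'D_v u x = \sum_(i < N) v ord0 i * grad u x ord0 i.
Proof.
move=> du; rewrite deriveE// {1}(row_sum_delta v) linear_sum/=.
by apply: eq_bigr => i _; rewrite linearZ/= mxE deriveE.
Qed.

Lemma derive_le_grad u x v : differentiable u x ->
  `|'D_v u x| <= N%:R * (enorm v * enorm (grad u x)).
Proof.
move=> du; rewrite derive_grad// (le_trans (ler_norm_sum _ _ _))//.
have -> : N%:R * (enorm v * enorm (grad u x)) =
    \sum_(i < N) (enorm v * enorm (grad u x)) by rewrite sumr_const card_ord mulr_natl.
by apply: ler_sum => i _; rewrite normrM ler_pM// coord_le_enorm.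
Qed.

Section path.
Variables (u : 'rV[R]_N -> R) (lam : R) (x : 'rV[R]_N).
Hypotheses (tu : test_function u) (x0 : x != 0) (lam_bnd : 2^-1 <= lam <= 2).

Let s (t : R) := 1 + t * (lam - 1).
Let v := (lam - 1) *: x.
Let phi (t : R) := u (s t *: x).
Let dphi (t : R) := 'D_v u (s t *: x).

Lemma path_scale_bnd t : 0 <= t <= 1 -> 2^-1 <= s t <= 2.
Proof. by move=> /andP[t0 t1]; case/andP: lam_bnd => l1 l2; rewrite /s; apply/andP; split; nra. Qed.

Let du t : 0 <= t <= 1 -> differentiable u (s t *: x).
Proof.
move=> /path_scale_bnd/andP[st _]; apply: (test_differentiable tu).
rewrite scaler_eq0 negb_or x0 andbT gt_eqF//; apply: lt_le_trans st.
by rewrite invr_gt0.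
Qed.

Let is_derive_phi t : 0 <= t <= 1 -> is_derive (t : R) (1 : R) phi (dphi t).
Proof.
move=> /du dut.
have E : (fun h : R => h^-1 *: ((phi \o shift t) (h *: (1 : R)) - phi t)) =
    (fun h : R => h^-1 *: ((u \o shift (s t *: x)) (h *: v) - u (s t *: x))).
  apply/funext => h; rewrite /phi /=; congr (_ *: (u _ - _)).
  by rewrite /v scalerA -scalerDl /s scaler1; congr (_ *: x); ring.
have dv : derivable u (s t *: x) v by exact: diff_derivable.
by split; [rewrite /derivable E|rewrite /derive E].
Qed.

Let s_continuous : continuous s.
Proof.
move=> t; apply: cvgD; first exact: cvg_cst.
by apply: cvgM; [exact: cvg_id|exact: cvg_cst].
Qed.

Lemma path_continuous : continuous (fun t => s t *: x).
Proof. by move=> t; apply: cvgZ; [exact: s_continuous|exact: cvg_cst]. Qed.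

Let dphi_continuous : {within `[0, 1], continuous dphi}.
Proof.
pose g (t : R) := \sum_(i < N) v ord0 i * grad u (s t *: x) ord0 i.
have cg : continuous g.
  apply: continuous_big => [|i _ t]; first exact: add_continuous.
  apply: cvgM; first exact: cvg_cst.
  apply: (continuous_comp (f := fun t => grad u (s t *: x)) (g := fun w : 'rV[R]_N => w ord0 i)).
    apply: (continuous_comp (f := fun t => s t *: x)); first exact: path_continuous.
    exact: (test_grad_continuous tu).
  exact: coord_continuous.
apply: (@subspace_eq_continuous _ _ _ g); last exact: continuous_subspaceT.
move=> t; rewrite inE/= in_itv/= => t01.
by rewrite /g /dphi/= -derive_grad//; exact: du.
Qed.

(** The fundamental theorem of calculus along the segment from x to lam x.  The
factor N comes from bounding the directional derivative coordinatewise, and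
|lam - 1| <= 1. *)
Lemma increment_le_average :
  (`|u (lam *: x) - u x|%:E <= \int[lebesgue_measure]_(t in `[0%R, 1%R])
     (N%:R * (enorm x * enorm (grad u (s t *: x))))%:E)%E.
Proof.
have phi_cont t : 0 <= t <= 1 -> {for t, continuous phi}.
  move=> t01; apply: differentiable_continuous; apply/derivable1_diffP.
  exact: (@ex_derive _ _ _ _ _ _ _ (is_derive_phi t01)).
have FTC : (\int[lebesgue_measure]_(t in `[0%R, 1%R]) (dphi t)%:E =
    (phi 1)%:E - (phi 0)%:E)%E.
  apply: continuous_FTC2 => //.
    split.
    - move=> t; rewrite in_itv/= => /andP[t0 t1].
      have t01 : 0 <= t <= 1 by rewrite !ltW.
      exact: (@ex_derive _ _ _ _ _ _ _ (is_derive_phi t01)).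
    - by apply: cvg_at_right_filter; apply: phi_cont; rewrite lexx ler01.
    - by apply: cvg_at_left_filter; apply: phi_cont; rewrite lexx ler01.
  move=> t; rewrite in_itv/= => /andP[t0 t1].
  have t01 : 0 <= t <= 1 by rewrite !ltW.
  by rewrite derive1E; exact: (@derive_val _ _ _ _ _ _ _ (is_derive_phi t01)).
have -> : `|u (lam *: x) - u x|%:E = (`|(phi 1)%:E - (phi 0)%:E|)%E.
  rewrite -EFinD abse_EFin /phi /s mul1r mul0r addr0 scale1r.
  by congr (`|u (_ *: x) - _|%:E); ring.
rewrite -FTC.
have mdphi : measurable_fun (`[0, 1]%classic : set R) dphi.
  by apply: subspace_continuous_measurable_fun.
apply: (le_trans (le_abse_integral _ _ _)) => //.
  exact/measurable_EFinP.
apply: ge0_le_integral => //.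
- apply/measurable_EFinP; exact: measurableT_comp.
- apply/measurable_EFinP; apply: measurable_funS measurableT _ _ => //.
  apply: continuous_measurable_fun => t.
  apply: cvgM; first exact: cvg_cst.
  apply: cvgM; first exact: cvg_cst.
  apply: (continuous_comp (f := fun t => grad u (s t *: x)) (g := @enorm R N)).
    apply: (continuous_comp (f := fun t => s t *: x)); first exact: path_continuous.
    exact: (test_grad_continuous tu).
  exact: enorm_continuous.
move=> t; rewrite /= in_itv/= => t01; rewrite lee_fin.
apply: (le_trans (derive_le_grad _ (du t01))).
rewrite ler_wpM2l// ler_wpM2r ?enorm_ge0//.
rewrite /v enormZ.
rewrite ler_piMl ?enorm_ge0// ler_norml; case/andP: lam_bnd => l1 l2.
by apply/andP; split; lra.
Qed.

End path.

End test_functions.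

Section orlicz_measure.
Context {R : realType} {Psi : R -> R}.
Hypothesis HPsi : orlicz Psi.

Lemma measurable_orlicz_comp d (T : measurableType d) (D : set T) (f : T -> R) :
  measurable D -> measurable_fun D f -> (forall x, D x -> 0 <= f x) ->
  measurable_fun D (Psi \o f).
Proof.
move=> mD mf f0.
apply: (@measurable_comp _ _ _ _ _ _ (`[0, +oo[%classic : set R)) => //.
- by move=> _ [x Dx <-]; rewrite /= in_itv/= andbT f0.
- apply: subspace_continuous_measurable_fun => //.
  exact: (orlicz_continuous HPsi).
Qed.

(** Jensen's inequality: a supporting line of Psi at m is integrated.  Its slope
is nonnegative, so that a lower bound m of the mean of g suffices. *)
Lemma orlicz_jensen (g : R -> R) (m : R) : 0 <= m ->
  measurable_fun (`[0, 1]%classic : set R) g -> (forall t, 0 <= t <= 1 -> 0 <= g t) ->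
  (m%:E <= \int[lebesgue_measure]_(t in `[0%R, 1%R]) (g t)%:E)%E ->
  ((Psi m)%:E <= \int[lebesgue_measure]_(t in `[0%R, 1%R]) (Psi (g t))%:E)%E.
Proof.
move=> m0 mg g0 mle.
have mPg : measurable_fun (`[0, 1]%classic : set R) (Psi \o g).
  by apply: measurable_orlicz_comp => // t; rewrite /= in_itv/=; exact: g0.
have Pg0 t : 0 <= t <= 1 -> 0 <= Psi (g t).
  by move=> t01; rewrite (orlicz_ge0 HPsi)// g0.
have [->|mn] := eqVneq m 0.
  rewrite (orlicz0 HPsi); apply: integral_ge0 => t; rewrite /= in_itv/= => t01.
  by rewrite lee_fin Pg0.
have {mn}m0' : 0 < m by rewrite lt_neqAle eq_sym mn.
set k := right_derivative Psi m.
have k0 : 0 <= k.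
  rewrite -(pmulr_rge0 _ m0') (le_trans _ (p_minus_le HPsi m0'))//.
  rewrite mulr_ge0 ?(orlicz_ge0 HPsi)// (le_trans ler01)//.
  exact: p_minus_ge1.
have c1 (c : R) : (\int[lebesgue_measure]_(t in `[0%R, 1%R]) (cst c%:E) t = c%:E)%E.
  by rewrite integral_cst//= lebesgue_measure_itv/= lte_fin ltr01 oppr0 adde0 mule1.
rewrite -(@leeD2lE _ (k * m)%:E)//.
have -> : ((k * m)%:E + \int[lebesgue_measure]_(t in `[0%R, 1%R]) (Psi (g t))%:E =
    \int[lebesgue_measure]_(t in `[0%R, 1%R]) (k * m + Psi (g t))%:E)%E.
  rewrite -{1}(c1 (k * m)) -ge0_integralD//.
  - by move=> t _; rewrite lee_fin mulr_ge0// ltW.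
  - exact/measurable_EFinP.
apply: (@le_trans _ _ (\int[lebesgue_measure]_(t in `[0%R, 1%R]) (Psi m + k * g t)%:E)%E).
  under [leRHS]eq_integral do rewrite EFinD.
  rewrite ge0_integralD//; last 3 first.
  - by move=> t _; rewrite lee_fin (orlicz_ge0 HPsi).
  - by move=> t; rewrite /= in_itv/= => t01; rewrite lee_fin mulr_ge0// g0.
  - by apply/measurable_EFinP; apply: measurable_funM.
  rewrite addeC; apply: leeD; last first.
    by rewrite -[X in (X <= _)%E](c1 (Psi m)).
  under [leRHS]eq_integral do rewrite EFinM.
  rewrite ge0_integralZl_EFin//; last exact/measurable_EFinP.
  by rewrite EFinM lee_wpmul2l// lee_fin.
apply: ge0_le_integral => //.
- move=> t; rewrite /= in_itv/= => t01.
  by rewrite lee_fin addr_ge0 ?(orlicz_ge0 HPsi)// mulr_ge0// g0.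
- by apply/measurable_EFinP; apply: measurable_funD => //; apply: measurable_funM.
- by apply/measurable_EFinP; apply: measurable_funD.
move=> t; rewrite /= in_itv/= => t01; rewrite lee_fin.
by have := orlicz_subgradient HPsi (g0 _ t01) m0'; rewrite -/k; lra.
Qed.

End orlicz_measure.

(** * The weighted inequality *)

Section hardy_core.
Context {R : realType} {N : nat} (Psi : R -> R) (alpha gamma lam theta : R).
Hypotheses (N0 : (0 < N)%N) (HPsi : orlicz Psi) (gammaE : gamma = 1 - alpha).
Hypothesis lam_bnd : 2^-1 <= lam <= 2.
Hypothesis theta_bnd : forall t, 0 <= t -> Psi (lam `^ gamma * t) <= theta * Psi t.
Implicit Types (u : 'rV[R]_N -> R) (x : 'rV[R]_N).

Local Notation p := (p_plus Psi).

Definition hardy_lhs u x := Psi (`|u x| / enorm x `^ gamma).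
Definition hardy_rhs u x := Psi (enorm x `^ alpha * enorm (grad u x)).

(** 2^|alpha| compares |x|^alpha at two points of a segment, N is the loss in the
directional derivative, and the power p takes the factor out of Psi. *)
Definition hardy_cst := (N%:R * 2 `^ `|alpha|) `^ p.

Let lam0 : 0 < lam.
Proof. by case/andP: lam_bnd => l1 _; apply: lt_le_trans l1; rewrite invr_gt0. Qed.

Lemma hardy_lhs_ge0 u x : 0 <= hardy_lhs u x.
Proof. by rewrite (orlicz_ge0 HPsi)// divr_ge0// powR_ge0. Qed.

Lemma hardy_rhs_ge0 u x : 0 <= hardy_rhs u x.
Proof. by rewrite (orlicz_ge0 HPsi)// mulr_ge0 ?powR_ge0 ?enorm_ge0. Qed.

Lemma measurable_enorm_powR (c : R) :
  measurable_fun [set: 'rV[measurableTypeR R]_N] (fun x => @enorm R N x `^ c).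
Proof. exact: (measurableT_comp (@measurable_powR R c) (@measurable_enorm R N)). Qed.

Lemma measurable_hardy_lhs u : continuous u ->
  measurable_fun [set: 'rV[measurableTypeR R]_N] (hardy_lhs u).
Proof.
move=> cu; apply: (measurable_orlicz_comp HPsi) => //; last first.
  by move=> x _; rewrite divr_ge0// powR_ge0.
apply: measurable_funM.
  apply: measurableT_comp => //; exact: continuous_measurable_rV.
rewrite (_ : (fun x => _) = (fun x => @enorm R N x `^ (- gamma))).
  exact: measurable_enorm_powR.
by apply/funext => x; rewrite powRN.
Qed.

Lemma measurable_enorm_grad u : continuous (grad u) ->
  measurable_fun [set: 'rV[measurableTypeR R]_N] (fun x : 'rV[R]_N => enorm (grad u x)).
Proof.
move=> cu; apply: continuous_measurable_rV => x.
apply: (continuous_comp (f := grad u) (g := @enorm R N)); first exact: cu.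
exact: enorm_continuous.
Qed.

Lemma measurable_hardy_rhs u : continuous (grad u) ->
  measurable_fun [set: 'rV[measurableTypeR R]_N] (hardy_rhs u).
Proof.
move=> cu; apply: (measurable_orlicz_comp HPsi) => //; last first.
  by move=> x _; rewrite mulr_ge0 ?powR_ge0 ?enorm_ge0.
apply: measurable_funM; first exact: measurable_enorm_powR.
exact: measurable_enorm_grad.
Qed.

(** The increment of u from x to lam x, in the scale of the left-hand side, is
controlled by the mean of the right-hand side over the segment, because the
weights at two points of the segment are comparable. *)
Lemma increment_bound u x : test_function u -> x != 0 ->
  ((Psi (`|u x - u (lam *: x)| / enorm x `^ gamma))%:E <=
   hardy_cst%:E * segment_average lam (EFin \o hardy_rhs u) x)%E.
Proof.
move=> tu x0; have ex0 : 0 < enorm x by rewrite enorm_gt0.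
have N1 : 1 <= N%:R :> R by rewrite ler1n.
set k := N%:R * 2 `^ `|alpha|.
have k1 : 1 <= k.
  rewrite -[leLHS]mulr1 ler_pM//.
  have /= := @ler_powR _ 2 _ 0 `|alpha| (normr_ge0 _).
  by rewrite powRr0; apply; rewrite ler1n.
have k0 : 0 < k by rewrite (lt_le_trans _ k1).
have g0 : 0 < enorm x `^ gamma by exact: powR_gt0.
set d := `|_ - _|; have d0 : 0 <= d by exact: normr_ge0.
pose m := d / enorm x `^ gamma / k.
have m0 : 0 <= m by rewrite !divr_ge0 ?(ltW g0) ?(ltW k0).
have -> : d / enorm x `^ gamma = k * m by rewrite /m [RHS]mulrC divfK// gt_eqF.
apply: (@le_trans _ _ (hardy_cst * Psi m)%:E).
  by rewrite lee_fin (orlicz_scale_plus HPsi).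
rewrite EFinM lee_wpmul2l//; first by rewrite lee_fin powR_ge0.
pose s (t : R) := 1 + t * (lam - 1).
pose g t := enorm (s t *: x) `^ alpha * enorm (grad u (s t *: x)).
have gge t : 0 <= g t by rewrite mulr_ge0 ?powR_ge0 ?enorm_ge0.
have mpath : measurable_fun setT
    ((fun t => s t *: x) : measurableTypeR R -> 'rV[measurableTypeR R]_N).
  apply: measurable_fun_rVP => i; under eq_fun do rewrite mxE.
  apply: measurable_funM => //; apply: measurable_funD => //.
  exact: measurable_funM.
have mgr := measurable_enorm_grad (test_grad_continuous tu).
have mg : measurable_fun (`[0, 1]%classic : set R) g.
  apply: measurable_funS measurableT _ _ => //.
  apply: measurable_funM.
    exact: (measurableT_comp (measurable_enorm_powR alpha) mpath).
  exact: (measurableT_comp mgr mpath).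
apply: (orlicz_jensen HPsi (g := g)) => //.
have c0 : 0 < enorm x `^ gamma * k by rewrite mulr_gt0.
have -> : m = (enorm x `^ gamma * k)^-1 * d by rewrite /m; field; rewrite !gt_eqF.
have := increment_le_average tu x0 lam_bnd.
rewrite distrC -/d => dle.
rewrite EFinM; apply: (@le_trans _ _ ((enorm x `^ gamma * k)^-1%:E *
    \int[lebesgue_measure]_(t in `[0%R, 1%R]) (enorm x `^ gamma * k * g t)%:E)%E).
  rewrite lee_wpmul2l// ?lee_fin ?invr_ge0 ?(ltW c0)//.
  apply: (le_trans dle); apply: ge0_le_integral => //.
  - by move=> t _; rewrite lee_fin !mulr_ge0// enorm_ge0.
  - apply/measurable_EFinP; apply: measurable_funM => //; apply: measurable_funM => //.
    apply: measurable_funS measurableT _ _ => //.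
    exact: (measurableT_comp mgr mpath).
  - by apply/measurable_EFinP; apply: measurable_funM.
  move=> t; rewrite /= in_itv/= => t01; rewrite lee_fin.
  have st := path_scale_bnd lam_bnd t01; rewrite -/(s t) in st.
  have s0 : 0 <= s t.
    by case/andP: st => st _; apply: le_trans st; rewrite invr_ge0.
  have P1 := powR_dilation_bnd alpha st.
  rewrite /g /k enormZ (ger0_norm s0) powRM ?enorm_ge0//.
  set e := enorm (grad _ _); have e0 : 0 <= e by exact: enorm_ge0.
  have -> : enorm x `^ gamma * (N%:R * 2 `^ `|alpha|) * (s t `^ alpha * enorm x `^ alpha * e) =
    N%:R * ((enorm x `^ gamma * enorm x `^ alpha) * e) * (2 `^ `|alpha| * s t `^ alpha) by ring.
  rewrite -powRD ?(gt_eqF ex0) ?implybT//.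
  rewrite gammaE subrK powRr1 ?enorm_ge0// ler_peMr//.
  by rewrite !mulr_ge0// enorm_ge0.
under eq_integral do rewrite EFinM.
rewrite ge0_integralZl_EFin//; last 3 first.
- by move=> t _; rewrite lee_fin.
- exact/measurable_EFinP.
- exact: ltW.
by rewrite muleA -EFinM mulVf ?gt_eqF// mul1e.
Qed.

(** Quasi-additivity, applied to the value carried over from lam x and to the
increment. *)
Lemma hardy_lhs_two_points u x e : test_function u -> x != 0 -> 0 < e -> e <= 1 ->
  ((hardy_lhs u x)%:E <=
   ((1 + p * 2 `^ p * e) * theta * hardy_lhs u (lam *: x))%:E +
   (p * 2 `^ p * e `^ (1 - p) * hardy_cst)%:E *
     segment_average lam (EFin \o hardy_rhs u) x)%E.
Proof.
move=> tu x0 e0 e1; have ex0 : 0 < enorm x by rewrite enorm_gt0.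
have g0 : 0 < enorm x `^ gamma by exact: powR_gt0.
set a := `|u (lam *: x)| / enorm x `^ gamma.
set b := `|u x - u (lam *: x)| / enorm x `^ gamma.
have a0 : 0 <= a by rewrite divr_ge0// ltW.
have b0 : 0 <= b by rewrite divr_ge0// ltW.
have xab : hardy_lhs u x <= Psi (a + b).
  apply: (orlicz_le HPsi); first by rewrite divr_ge0// ltW.
  rewrite -mulrDl ler_wpM2r ?invr_ge0 ?(ltW g0)//.
  by rewrite -[X in `|X| <= _](subrK (u (lam *: x))) addrC (le_trans (ler_normD _ _))// addrC.
have p0 : 0 <= p by rewrite (le_trans ler01)// p_plus_ge1.
have C0 : 0 <= p * 2 `^ p by rewrite mulr_ge0// powR_ge0.
apply: (@le_trans _ _ (Psi (a + b))%:E); first by rewrite lee_fin.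
apply: (@le_trans _ _ ((1 + p * 2 `^ p * e) * Psi a +
                 p * 2 `^ p * e `^ (1 - p) * Psi b)%:E).
  by rewrite lee_fin; exact: (orlicz_add HPsi).
rewrite EFinD; apply: leeD.
  rewrite lee_fin -[leRHS]mulrA ler_wpM2l//.
    by rewrite addr_ge0// mulr_ge0// ltW.
  have -> : a = lam `^ gamma * (`|u (lam *: x)| / enorm (lam *: x) `^ gamma).
    rewrite enormZ (gtr0_norm lam0) powRM ?enorm_ge0 ?(ltW lam0)//.
    by rewrite /a; field; rewrite !gt_eqF// powR_gt0.
  by apply: theta_bnd; rewrite divr_ge0// powR_ge0.
rewrite !(EFinM (_ * _)) -[leRHS]muleA lee_wpmul2l//.
  by rewrite lee_fin mulr_ge0// powR_ge0.
exact: increment_bound.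
Qed.

(** The common form of all four inequalities.  The region S contains the
support of u, w is the weight carried by the absorption argument, e(x) the
parameter of quasi-additivity chosen at x, and z the weight that is obtained.
The last hypothesis says that the bound which the dilation transports from
lam^-1 x leaves a surplus z of the weight at x. *)
Section weighted.
Variables (S : set 'rV[R]_N) (w e z : 'rV[R]_N -> R) (c Bw : R).
Hypothesis mw : measurable_fun [set: 'rV[measurableTypeR R]_N] w.
Hypothesis me : measurable_fun [set: 'rV[measurableTypeR R]_N] e.
Hypothesis mz : measurable_fun [set: 'rV[measurableTypeR R]_N] z.
Hypotheses (w0 : forall x, 0 <= w x) (z0 : forall x, 0 <= z x) (c0 : 0 <= c).
Hypothesis theta0 : 0 <= theta.
Hypothesis SV : forall x, S x -> S (lam^-1 *: x).
Hypothesis e01 : forall x, x != 0 -> S x -> 0 < e x <= 1.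
Hypothesis wBw : forall x, x != 0 -> S x -> w x <= Bw.
Hypothesis we : forall x, x != 0 -> S x -> w x * e x `^ (1 - p) <= c.
Hypothesis wz : forall x, x != 0 -> S x ->
  lam^-1 ^+ N * (w (lam^-1 *: x) * ((1 + p * 2 `^ p * e (lam^-1 *: x)) * theta)) +
  z x <= w x.

Definition weighted_cst := c * (p * 2 `^ p * hardy_cst) * 2 ^+ N.

(** The truncation keeps |x| >= eta and thereby makes the integrals to be
absorbed finite.  It must not cut off lam x before x unless u vanishes there;
for lam < 1 this requires that u vanish near the origin. *)
Lemma truncated_weighted_hardy u (eta : R) : test_function u -> 0 < eta ->
  (forall x, u x != 0 -> S x) ->
  (forall x, eta <= enorm x -> u (lam *: x) != 0 -> eta <= enorm (lam *: x)) ->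
  (\int[lebesgue_rV N]_(x in [set x | eta <= enorm x]%R) (z x * hardy_lhs u x)%:E <=
   weighted_cst%:E * \int[lebesgue_rV N]_x (hardy_rhs u x)%:E)%E.
Proof.
move=> tu eta0 uS etaP.
set D := [set x | eta <= enorm x].
have mD : measurable (D : set 'rV[measurableTypeR R]_N) by exact: measurable_enorm_ge.
have Dn0 x : D x -> x != 0.
  by move=> Dx; rewrite -enorm_gt0; exact: lt_le_trans Dx.
pose f : 'rV[measurableTypeR R]_N -> R := (hardy_lhs u) \_ D.
have mlhs := measurable_hardy_lhs (test_continuous tu).
have mrhs := measurable_hardy_rhs (test_grad_continuous tu).
have mf : measurable_fun [set: 'rV[measurableTypeR R]_N] f.
  by apply/(measurable_restrictT _ mD); exact: measurable_funS mlhs.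
have f0 x : 0 <= f x by rewrite /f patchE; case: ifPn => // _; exact: hardy_lhs_ge0.
have fD x : D x -> f x = hardy_lhs u x by move=> Dx; rewrite /f patchE mem_set.
have lhs0 x : u x = 0 -> hardy_lhs u x = 0.
  by move=> ux; rewrite /hardy_lhs ux normr0 mul0r (orlicz0 HPsi).
have fn x : f x != 0 -> [/\ D x, u x != 0 & S x].
  rewrite /f patchE; case: ifPn => [/set_mem Dx|_]; last by rewrite eqxx.
  move=> fx; have ux : u x != 0 by apply: contra_neq fx; exact: lhs0.
  by split => //; exact: uS.
have [p0 C0] : 0 <= p /\ 0 <= p * 2 `^ p.
  have p0 : 0 <= p by rewrite (le_trans ler01)// p_plus_ge1.
  by rewrite p0 mulr_ge0// powR_ge0.
pose P x := w x * f x.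
pose A x := w x * ((1 + p * 2 `^ p * e x) * theta).
pose Q x := A (lam^-1 *: x) * f x.
pose Z x := z x * f x.
have scaleV x : (lam^-1 *: x == 0) = (x == 0).
  by rewrite scaler_eq0 invr_eq0 (gt_eqF lam0).
have A0 x : x != 0 -> S x -> 0 <= A x.
  move=> xn Sx; have /andP[ex _] := e01 xn Sx.
  by rewrite /A !mulr_ge0// addr_ge0// mulr_ge0// ltW.
have Q0 x : 0 <= Q x.
  rewrite /Q; have [->|/fn[Dx _ Sx]] := eqVneq (f x) 0; first by rewrite mulr0.
  by rewrite mulr_ge0// A0 ?scaleV ?Dn0//; exact: SV.
have mscale := @measurable_scalel_rV R N lam^-1.
have mA : measurable_fun [set: 'rV[measurableTypeR R]_N] A.
  apply: measurable_funM => //; apply: measurable_funM => //.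
  by apply: measurable_funD => //; exact: measurable_funM.
have mQ : measurable_fun [set: 'rV[measurableTypeR R]_N] Q.
  apply: measurable_funM => //; exact: (measurableT_comp mA mscale).
have Gm : measurable_fun [set: 'rV[measurableTypeR R]_N] (EFin \o hardy_rhs u).
  exact/measurable_EFinP.
have G0 x : (0 <= (EFin \o hardy_rhs u) x)%E by rewrite lee_fin hardy_rhs_ge0.
have h0 : 0 <= hardy_cst by exact: powR_ge0.
pose k := c * (p * 2 `^ p * hardy_cst).
pose H x := (k%:E * segment_average lam (EFin \o hardy_rhs u) x)%E.
have k0 : 0 <= k by rewrite !mulr_ge0// powR_ge0.
have H0 x : (0 <= H x)%E.
  by rewrite mule_ge0 ?lee_fin// segment_average_ge0.
have mS : measurable_fun [set: 'rV[measurableTypeR R]_N]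
    (segment_average lam (EFin \o hardy_rhs u)) by exact: measurable_segment_average.
have mH : measurable_fun [set: 'rV[measurableTypeR R]_N] H by exact: measurable_funeM.
have ZH : (\int[lebesgue_rV N]_x (Z x)%:E <= \int[lebesgue_rV N]_x H x)%E.
  apply: (@dilation_absorption _ N lam P Q Z H) => //.
  - exact: measurable_funM.
  - exact: measurable_funM.
  - by move=> x; rewrite mulr_ge0.
  - by move=> x; rewrite mulr_ge0.
  - move=> x; rewrite /P; have [->|/fn[Dx _ Sx]] := eqVneq (f x) 0.
      by rewrite mulr0 adde_ge0// lee_fin.
    have xn := Dn0 _ Dx; have /andP[ex0 ex1] := e01 xn Sx.
    have := hardy_lhs_two_points tu xn ex0 ex1; rewrite -fD// => two.
    have flam : f (lam *: x) = hardy_lhs u (lam *: x).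
      have [ul|ul] := eqVneq (u (lam *: x)) 0; last by rewrite fD//; exact: etaP.
      by rewrite /f patchE lhs0//; case: ifPn.
    have wx : (0 <= (w x)%:E)%E by rewrite lee_fin.
    rewrite EFinM; apply: (le_trans (lee_wpmul2l wx two)).
    rewrite ge0_muleDr; last 2 first.
    - by rewrite lee_fin !mulr_ge0 ?hardy_lhs_ge0// addr_ge0// mulr_ge0// ltW.
    - by rewrite mule_ge0 ?segment_average_ge0// lee_fin !mulr_ge0 ?powR_ge0.
    apply: leeD.
      rewrite -EFinM lee_fin /Q /A scalerA mulVf ?gt_eqF// scale1r flam.
      by rewrite !mulrA.
    rewrite muleA -EFinM /H lee_wpmul2r ?segment_average_ge0// lee_fin /k.
    have -> : w x * (p * 2 `^ p * e x `^ (1 - p) * hardy_cst) =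
      (w x * e x `^ (1 - p)) * (p * 2 `^ p * hardy_cst) by ring.
    by rewrite ler_wpM2r ?mulr_ge0 ?powR_ge0// we.
  - move=> x; rewrite /P /Q /Z; have [->|/fn[Dx _ Sx]] := eqVneq (f x) 0.
      by rewrite !mulr0 addr0.
    by rewrite mulrA -mulrDl ler_wpM2r// /A; exact: wz (Dn0 _ Dx) Sx.
  have [M HM] := test_support tu; have [B HB] := test_bounded tu.
  pose Bf := Psi (`|B| * ((eta `^ gamma)^-1 + (M `^ gamma)^-1)).
  have B0 : 0 <= `|B| * ((eta `^ gamma)^-1 + (M `^ gamma)^-1).
    by rewrite mulr_ge0// addr_ge0// invr_ge0 powR_ge0.
  have fB x : f x <= Bf.
    have [->|fx] := eqVneq (f x) 0; first exact: (orlicz_ge0 HPsi).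
    have [Dx ux Sx] := fn _ fx; rewrite fD//.
    apply: (orlicz_le HPsi); first by rewrite divr_ge0// powR_ge0.
    apply: ler_pM => //; first by rewrite invr_ge0 powR_ge0.
      by rewrite (le_trans (HB x))// ler_norm.
    by apply: powRN_between => //; exact: HM.
  apply: (@integral_bounded_lty _ _ P (`|Bw| * Bf) M).
  - exact: measurable_funM.
  - move=> x; rewrite /P mulr_ge0//=.
    have [->|fx] := eqVneq (f x) 0.
      by rewrite mulr0 mulr_ge0// (le_trans (f0 x)).
    have [Dx ux Sx] := fn _ fx.
    by rewrite ler_pM// (le_trans (wBw (Dn0 _ Dx) Sx))// ler_norm.
  - by move=> x; rewrite /P mulf_eq0 negb_or => /andP[_ /fn[_ ux _]]; exact: HM.
have -> : (\int[lebesgue_rV N]_(x in D) (z x * hardy_lhs u x)%:E =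
    \int[lebesgue_rV N]_x (Z x)%:E)%E.
  rewrite integral_mkcond; apply: eq_integral => x _.
  by rewrite /Z /f !patchE; case: ifPn => //; rewrite mulr0.
apply: (le_trans ZH); rewrite /H ge0_integralZl_EFin//; last first.
  by move=> x _; exact: segment_average_ge0.
rewrite /weighted_cst -/k [in leRHS]EFinM -[leRHS]muleA lee_wpmul2l//.
exact: integral_segment_average.
Qed.

Lemma weighted_hardy u : test_function u -> (forall x, u x != 0 -> S x) ->
  (1 <= lam \/ exists2 r, 0 < r & forall x, enorm x < r -> u x = 0) ->
  (\int[lebesgue_rV N]_x (z x * hardy_lhs u x)%:E <=
   weighted_cst%:E * \int[lebesgue_rV N]_x (hardy_rhs u x)%:E)%E.
Proof.
move=> tu uS cond.
have [r r0 Hr] : exists2 r, 0 < r & forall eta x, 0 < eta -> eta <= r ->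
    eta <= enorm x -> u (lam *: x) != 0 -> eta <= enorm (lam *: x).
  case: cond => [lam1|[r r0 ur]].
    exists 1 => // eta x _ _ ex _; rewrite enormZ (gtr0_norm lam0).
    by rewrite (le_trans ex)// ler_peMl ?enorm_ge0.
  exists r => // eta x _ er _; apply: contraNT; rewrite -ltNge => lt.
  by apply/eqP/ur; exact: lt_le_trans er.
have mg : measurable_fun [set: 'rV[measurableTypeR R]_N]
    (fun x => (z x * hardy_lhs u x)%:E).
  apply/measurable_EFinP; apply: measurable_funM => //.
  exact: measurable_hardy_lhs (test_continuous tu).
have g0 x : (0 <= (z x * hardy_lhs u x)%:E)%E.
  by rewrite lee_fin mulr_ge0// hardy_lhs_ge0.
rewrite (integral_eq_compl0 N0 mg g0).
pose F k : set 'rV[measurableTypeR R]_N := [set x | k.+1%:R^-1 <= enorm x].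
have ndF : nondecreasing_seq F.
  move=> i j ij; apply/subsetPset => x /=; apply: le_trans.
  by rewrite lef_pV2 ?posrE ?ltr0n// ler_nat ltnS.
have mF k : measurable (F k) by exact: measurable_enorm_ge.
have mgF k : measurable_fun (F k) (fun x => (z x * hardy_lhs u x)%:E).
  exact: measurable_funS mg.
have cvgF : (\int[lebesgue_rV N]_(x in F k) (z x * hardy_lhs u x)%:E)%E @[k --> \oo] -->
    (\int[lebesgue_rV N]_(x in \bigcup_k F k) (z x * hardy_lhs u x)%:E)%E.
  by apply: ge0_nondecreasing_set_cvg_integral => // k x _; exact: g0.
rewrite -(cvg_lim _ cvgF)//; apply: lime_le; first by apply/cvg_ex; eexists; exact: cvgF.
have [m] := ltr_add_invr r0; rewrite add0r => mr.
near=> k; apply: truncated_weighted_hardy => //.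
move=> x; apply: Hr => //.
apply: le_trans (ltW mr); rewrite lef_pV2 ?posrE ?ltr0n// ler_nat ltnS.
by near: k; exists m.
Unshelve. all: by end_near. Qed.

End weighted.

End hardy_core.

(** * The subcritical and the critical regime *)

Section two_regimes.
Context {R : realType} {N : nat} (Psi : R -> R) (alpha gamma lam theta : R).
Hypotheses (N0 : (0 < N)%N) (HPsi : orlicz Psi) (gammaE : gamma = 1 - alpha).
Hypothesis lam_bnd : 2^-1 <= lam <= 2.
Hypothesis theta_bnd : forall t, 0 <= t -> Psi (lam `^ gamma * t) <= theta * Psi t.
Hypothesis theta0 : 0 <= theta.
Implicit Types (u : 'rV[R]_N -> R) (x : 'rV[R]_N).

Local Notation p := (p_plus Psi).

Let lam0 : 0 < lam.
Proof. by case/andP: lam_bnd => l1 _; apply: lt_le_trans l1; rewrite invr_gt0. Qed.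

Let C := p * 2 `^ p.
Let C0 : 0 <= C.
Proof. by rewrite mulr_ge0 ?powR_ge0// (le_trans ler01)// p_plus_ge1. Qed.

(** Constant weights: the dilation contracts by the factor theta / lam^N < 1,
which leaves room for a fixed parameter of quasi-additivity. *)
Lemma subcritical_hardy : lam^-1 ^+ N * theta < 1 ->
  exists2 K, 0 < K & forall u, test_function u ->
    (1 <= lam \/ exists2 r, 0 < r & forall x, enorm x < r -> u x = 0) ->
    (\int[lebesgue_rV N]_x (hardy_lhs Psi gamma u x)%:E <=
     K%:E * \int[lebesgue_rV N]_x (hardy_rhs Psi alpha u x)%:E)%E.
Proof.
set rho := _ * theta => rho1.
have lN : 0 <= lam^-1 ^+ N by rewrite exprn_ge0// invr_ge0 ltW.
have rho0 : 0 <= rho by rewrite mulr_ge0.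
(* half of the gap 1 - rho pays for the error C * rho * e, half is kept *)
pose d := (1 - rho) / 2.
have d0 : 0 < d by rewrite /d; lra.
have Cr0 : 0 < C * rho + 1 by rewrite ltr_wpDl// mulr_ge0.
pose e := Num.min 1 (d / (C * rho + 1)).
have e0 : 0 < e by rewrite lt_min ltr01 divr_gt0.
have e1 : e <= 1 by rewrite ge_min lexx.
have eC : C * rho * e <= d.
  apply: (@le_trans _ _ ((C * rho + 1) * e)); first by rewrite ler_wpM2r ?(ltW e0)// lerDl.
  by rewrite mulrC -ler_pdivlMr// ge_min lexx orbT.
pose K := d^-1 * weighted_cst (N := N) Psi alpha (e `^ (1 - p)).
have H u : test_function u ->
    (1 <= lam \/ exists2 r, 0 < r & forall x, enorm x < r -> u x = 0) ->
    (\int[lebesgue_rV N]_x (hardy_lhs Psi gamma u x)%:E <=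
     K%:E * \int[lebesgue_rV N]_x (hardy_rhs Psi alpha u x)%:E)%E.
  move=> tu cond.
  have W : (\int[lebesgue_rV N]_x (d * hardy_lhs Psi gamma u x)%:E <=
     (weighted_cst (N := N) Psi alpha (e `^ (1 - p)))%:E *
     \int[lebesgue_rV N]_x (hardy_rhs Psi alpha u x)%:E)%E.
    apply: (@weighted_hardy R N Psi alpha gamma lam theta N0 HPsi gammaE lam_bnd
      theta_bnd setT (cst 1) (cst e) (cst d) (e `^ (1 - p)) 1) => //.
    - by move=> x; exact: ltW.
    - exact: powR_ge0.
    - by move=> x _ _; rewrite /cst e0 e1.
    - by move=> x _ _; rewrite /cst mul1r.
    - move=> x _ _; rewrite /cst mul1r mulrCA -/rho -/C.
      by rewrite /d in eC *; lra.
  have mlhs : measurable_fun [set: 'rV[measurableTypeR R]_N] (hardy_lhs Psi gamma u).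
    exact: measurable_hardy_lhs (test_continuous tu).
  rewrite /K EFinM -muleA.
  apply: (@le_trans _ _ (d^-1%:E * \int[lebesgue_rV N]_x (d * hardy_lhs Psi gamma u x)%:E)%E).
    under [X in (_ <= _ * X)%E]eq_integral do rewrite EFinM.
    rewrite ge0_integralZl_EFin//; last 3 first.
    - by move=> x _; rewrite lee_fin hardy_lhs_ge0.
    - exact/measurable_EFinP.
    - exact: ltW.
    by rewrite muleA -EFinM mulVf ?gt_eqF// mul1e.
  by rewrite lee_wpmul2l// lee_fin invr_ge0 ltW.
exists (`|K| + 1); first by rewrite ltr_wpDl.
move=> u tu cond; apply: (le_trans (H u tu cond)).
rewrite lee_wpmul2r ?lee_fin//; last by rewrite (le_trans (ler_norm _))// lerDl.
by apply: integral_ge0 => x _; rewrite lee_fin hardy_rhs_ge0.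
Qed.

(** When theta = lam^N the gain comes from the weight L^(1 - p).  It decreases by
at least (p - 1) ln 2 L^-p when L increases by ln 2, up to a constant, because
L >= ln 2. *)
Lemma critical_hardy (S : set 'rV[R]_N) (L : 'rV[R]_N -> R) :
  lam^-1 ^+ N * theta = 1 ->
  measurable_fun [set: 'rV[measurableTypeR R]_N] L ->
  (forall x, S x -> S (lam^-1 *: x)) ->
  (forall x, x != 0 -> S x -> ln 2 <= L x) ->
  (forall x, x != 0 -> S x -> L (lam^-1 *: x) = L x + ln 2) ->
  exists2 K, 0 < K & forall u, test_function u -> (forall x, u x != 0 -> S x) ->
    (1 <= lam \/ exists2 r, 0 < r & forall x, enorm x < r -> u x = 0) ->
    (\int[lebesgue_rV N]_x (L x `^ (- p) * hardy_lhs Psi gamma u x)%:E <=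
     K%:E * \int[lebesgue_rV N]_x (hardy_rhs Psi alpha u x)%:E)%E.
Proof.
move=> rho1 mL SV SL LV.
have l2 : 0 < ln 2 :> R by rewrite ln_gt0// ltr1n.
have p1 : 1 < p by exact: p_plus_gt1.
have p10 : 0 < p - 1 by lra.
have p0 : 0 <= p by lra.
(* the loss C * dl has to stay below half of the gain p - 1 *)
pose dl := Num.min 1 ((p - 1) / (2 * C + 1)).
have C1 : 0 < 2 * C + 1 by rewrite ltr_wpDl// mulr_ge0.
have dl0 : 0 < dl by rewrite lt_min ltr01 divr_gt0.
have dl1 : dl <= 1 by rewrite ge_min lexx.
have dlC : C * dl <= (p - 1) / 2.
  have : dl * (2 * C + 1) <= p - 1 by rewrite -ler_pdivlMr// ge_min lexx orbT.
  rewrite ler_pdivlMr// => /(le_trans _); apply.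
  have -> : dl * (2 * C + 1) = C * dl * 2 + dl by ring.
  by rewrite lerDl ltW.
pose b := (p - 1) * ln 2 / 2 * 2 `^ (- p).
have b0 : 0 < b by rewrite /b mulr_gt0 ?powR_gt0// divr_gt0// mulr_gt0.
pose w x := L x `^ (- (p - 1)).
pose e x := dl * ln 2 * L x `^ (- 1).
pose z x := b * L x `^ (- p).
pose c := (dl * ln 2) `^ (1 - p).
have dl20 : 0 < dl * ln 2 by rewrite mulr_gt0.
have Lgt x : x != 0 -> S x -> 0 < L x.
  by move=> xn Sx; exact: lt_le_trans l2 (SL _ xn Sx).
have scaleV x : (lam^-1 *: x == 0) = (x == 0).
  by rewrite scaler_eq0 invr_eq0 (gt_eqF lam0).
pose K := b^-1 * weighted_cst (N := N) Psi alpha c.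
have mLp q : measurable_fun [set: 'rV[measurableTypeR R]_N] (fun x => L x `^ q).
  exact: (measurableT_comp (@measurable_powR R q) mL).
have H u : test_function u -> (forall x, u x != 0 -> S x) ->
    (1 <= lam \/ exists2 r, 0 < r & forall x, enorm x < r -> u x = 0) ->
    (\int[lebesgue_rV N]_x (L x `^ (- p) * hardy_lhs Psi gamma u x)%:E <=
     K%:E * \int[lebesgue_rV N]_x (hardy_rhs Psi alpha u x)%:E)%E.
  move=> tu uS cond.
  have W : (\int[lebesgue_rV N]_x (z x * hardy_lhs Psi gamma u x)%:E <=
     (weighted_cst (N := N) Psi alpha c)%:E *
     \int[lebesgue_rV N]_x (hardy_rhs Psi alpha u x)%:E)%E.
    apply: (@weighted_hardy R N Psi alpha gamma lam theta N0 HPsi gammaE lam_bnd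
      theta_bnd S w e z c (ln 2 `^ (- (p - 1)))) => //.
    - exact: mLp.
    - by apply: measurable_funM => //; exact: mLp.
    - by apply: measurable_funM => //; exact: mLp.
    - by move=> x; exact: powR_ge0.
    - by move=> x; rewrite mulr_ge0 ?powR_ge0// ltW.
    - exact: powR_ge0.
    - move=> x xn Sx; have Lx := Lgt _ xn Sx.
      rewrite /e powR_inv1 ?(ltW Lx)// divr_gt0//= ler_pdivrMr// mul1r (le_trans _ (SL _ xn Sx))//.
      by rewrite ler_piMl// ltW.
    - by move=> x xn Sx; apply: ler_powRN; [exact: ltW|exact: l2|exact: SL].
    - move=> x xn Sx; have Lx := Lgt _ xn Sx; rewrite /w /e /c.
      rewrite powRM ?powR_ge0 ?(ltW dl20)// -powRrM.
      rewrite mulrCA -powRD; last by rewrite (gt_eqF Lx) implybT.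
      by rewrite (_ : - (p - 1) + -1 * (1 - p) = 0) ?powRr0 ?mulr1//; ring.
    - move=> x xn Sx; have Lx := Lgt _ xn Sx; have Lx2 := SL _ xn Sx.
      have -> : lam^-1 ^+ N * (w (lam^-1 *: x) * ((1 + p * 2 `^ p * e (lam^-1 *: x)) * theta)) =
          (lam^-1 ^+ N * theta) * (w (lam^-1 *: x) * (1 + C * e (lam^-1 *: x))).
        by rewrite /C; ring.
      rewrite rho1 mul1r /w /e /z LV//.
      rewrite powR_inv1; last by rewrite addr_ge0// ltW.
      set l := L x in Lx Lx2 *; set M := l + ln 2.
      have M0 : 0 < M by rewrite addr_gt0.
      (* the tangent at M bounds the drop of the weight from l to M <= 2 l *)
      have tan := powR_tangent (ltW p10) M0 Lx.
      apply: le_trans tan.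
      have MpE : M `^ (- p) = M `^ (- (p - 1)) / M.
        rewrite -[X in _ / X](powRr1 (ltW M0)) -powRB; last by rewrite (gt_eqF M0) implybT.
        by congr (_ `^ _); ring.
      have zM : b * l `^ (- p) <= (p - 1) * ln 2 / 2 * (M `^ (- (p - 1)) / M).
        rewrite /b -mulrA -powRM ?(ltW Lx)// -MpE ler_wpM2l//.
          by rewrite divr_ge0// mulr_ge0 ?(ltW p10) ?(ltW l2).
        by apply: ler_powRN => //; rewrite /M; lra.
      set V := M `^ (- (p - 1)) in MpE zM *.
      have V0 : 0 <= V / M by rewrite divr_ge0 ?powR_ge0 ?ltW.
      have -> : V * (1 - (p - 1) * (l - M) / M) = V + (p - 1) * ln 2 * (V / M).
        by rewrite /M; field; rewrite gt_eqF.
      have -> : V * (1 + C * (dl * ln 2 / M)) = V + C * dl * (ln 2 * (V / M)).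
        by field; rewrite gt_eqF.
      have VM : 0 <= ln 2 * (V / M) by rewrite mulr_ge0// ltW.
      have := ler_wpM2r VM dlC.
      move: zM; rewrite -!(mulrA (p - 1)).
      have -> : (p - 1) * (ln 2 / 2 * (V / M)) = (p - 1) / 2 * (ln 2 * (V / M)).
        by field; rewrite gt_eqF.
      move: (ln 2 * _) (b * _) (C * dl) => X1 X2 X3.
      by lra.
  have mlhs : measurable_fun [set: 'rV[measurableTypeR R]_N] (hardy_lhs Psi gamma u).
    exact: measurable_hardy_lhs (test_continuous tu).
  rewrite /K EFinM -muleA.
  apply: (@le_trans _ _ (b^-1%:E * \int[lebesgue_rV N]_x (z x * hardy_lhs Psi gamma u x)%:E)%E).
    under [X in (_ <= _ * X)%E]eq_integral do rewrite /z -mulrA EFinM.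
    rewrite ge0_integralZl_EFin//; last 3 first.
    - by move=> x _; rewrite lee_fin mulr_ge0 ?powR_ge0 ?hardy_lhs_ge0.
    - by apply/measurable_EFinP; apply: measurable_funM => //; exact: mLp.
    - exact: ltW.
    by rewrite muleA -EFinM mulVf ?gt_eqF// mul1e.
  by rewrite lee_wpmul2l// lee_fin invr_ge0 ltW.
exists (`|K| + 1); first by rewrite ltr_wpDl.
move=> u tu uS cond; apply: (le_trans (H u tu uS cond)).
rewrite lee_wpmul2r ?lee_fin//; last by rewrite (le_trans (ler_norm _))// lerDl.
by apply: integral_ge0 => x _; rewrite lee_fin hardy_rhs_ge0.
Qed.

End two_regimes.

(** * Divergence for a cutoff function *)

Section bump.
Context {R : realType}.
Implicit Types t h : R.

(** This criterion treats max(0, t)^2 uniformly, breakpoint included. *)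
Lemma is_derive_quadratic_error (f : R -> R) t a :
  (forall h, `|f (t + h) - f t - a * h| <= h ^+ 2) -> is_derive t 1 f a.
Proof.
move=> fq.
have q : h^-1 *: (f (h *: 1 + t) - f t) @[h --> 0^'] --> a.
  apply/cvgrPdist_le => /= e e0; near=> h.
  have h0 : h != 0 by near: h; exact: nbhs_dnbhs_neq.
  have he : `|h| <= e.
    near: h; apply: dnbhs0_le => //.
  rewrite scaler1 [h + t]addrC.
  have -> : a - h^-1 *: (f (t + h) - f t) = - (h^-1 * (f (t + h) - f t - a * h)).
    by rewrite /GRing.scale/=; field.
  rewrite normrN normrM normfV ler_pdivrMl ?normr_gt0//.
  apply: (le_trans (fq h)); rewrite -real_normK ?num_real// expr2.
  by rewrite ler_wpM2l.
split; first by apply/cvg_ex; exists a.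
exact: cvg_lim q.
Unshelve. all: by end_near. Qed.

Definition sqr_pos t := Num.max 0 t ^+ 2.

Lemma max0E t : Num.max 0 t = if 0 <= t then t else 0.
Proof. by case: leP. Qed.

Lemma is_derive_sqr_pos t : is_derive t 1 sqr_pos (2 * Num.max 0 t).
Proof.
apply: is_derive_quadratic_error => h; rewrite /sqr_pos !max0E.
by rewrite ler_norml; case: ifP; case: ifP => /idP; rewrite -?real_ltNge ?num_real//
  => h1 h2; apply/andP; split; nra.
Qed.

(** A C^1 cutoff: 1 below 1, 0 above 2. *)
Definition cutoff t := sqr_pos (1 - sqr_pos (t - 1)).
Definition dcutoff t := - (4 * Num.max 0 (1 - sqr_pos (t - 1)) * Num.max 0 (t - 1)).

Lemma is_derive_cutoff t : is_derive t 1 cutoff (dcutoff t).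
Proof.
have d1 : is_derive t 1 (fun t => t - 1) (1 : R).
  by apply: is_derive_eq; rewrite subr0.
have d2 := @is_derive1_comp _ sqr_pos (fun t => t - 1) t _ _ (is_derive_sqr_pos _) d1.
have d3 : is_derive t 1 (fun t => 1 - sqr_pos (t - 1)) (0 - (2 * Num.max 0 (t - 1)) * 1).
  exact: is_deriveB.
have := @is_derive1_comp _ sqr_pos (fun t => 1 - sqr_pos (t - 1)) t _ _ (is_derive_sqr_pos _) d3.
rewrite (_ : dcutoff t = 2 * Num.max 0 (1 - sqr_pos (t - 1)) * (0 - 2 * Num.max 0 (t - 1) * 1))//.
by rewrite /dcutoff; ring.
Qed.

Lemma max0_continuous : continuous (Num.max 0 : R -> R).
Proof. by move=> t; apply: continuous_max; [exact: cvg_cst|exact: cvg_id]. Qed.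

Lemma sqr_pos_continuous : continuous sqr_pos.
Proof.
move=> t; apply: differentiable_continuous; apply/derivable1_diffP.
exact: (@ex_derive _ _ _ _ _ _ _ (is_derive_sqr_pos t)).
Qed.

Lemma dcutoff_continuous : continuous dcutoff.
Proof.
have c1 : continuous (fun t : R => t - 1).
  by move=> t; apply: cvgB; [exact: cvg_id|exact: cvg_cst].
move=> t; apply: cvgN; apply: cvgM; first (apply: cvgM; first exact: cvg_cst).
  apply: (continuous_comp (f := fun t => 1 - sqr_pos (t - 1)) (g := Num.max 0)).
    apply: cvgB; first exact: cvg_cst.
    apply: (continuous_comp (f := fun t : R => t - 1)); first exact: c1.
    exact: sqr_pos_continuous.
  exact: max0_continuous.
apply: (continuous_comp (f := fun t : R => t - 1)); first exact: c1.
exact: max0_continuous.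
Qed.

Lemma cutoff1 t : t <= 1 -> cutoff t = 1.
Proof.
move=> t1; rewrite /cutoff /sqr_pos (max_l (y := t - 1)); last by lra.
by rewrite expr0n/= subr0 max_r// expr1n.
Qed.

Lemma cutoff0 t : 2 <= t -> cutoff t = 0.
Proof.
move=> t2; rewrite /cutoff /sqr_pos (max_r (y := t - 1)); last by lra.
by rewrite max_l ?expr0n//; nra.
Qed.

Lemma dcutoff_eq0 t : t <= 1 \/ 2 <= t -> dcutoff t = 0.
Proof.
case=> t1; rewrite /dcutoff /sqr_pos.
  by rewrite (max_l (y := t - 1)) ?mulr0 ?oppr0//; lra.
rewrite (max_r (y := t - 1)); last by lra.
by rewrite max_l ?mulr0 ?mul0r ?oppr0//; nra.
Qed.

Lemma dcutoff_bnd t : `|dcutoff t| <= 4.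
Proof.
have [t2|t2] := leP 2 t; first by rewrite dcutoff_eq0 ?normr0; [|right].
rewrite /dcutoff normrN !normrM [`|4|]ger0_norm//.
have a1 : 0 <= Num.max 0 (t - 1) <= 1 by rewrite le_max lexx/= ge_max ler01/=; lra.
have a2 : 0 <= Num.max 0 (1 - sqr_pos (t - 1)) <= 1.
  rewrite le_max lexx/= ge_max ler01/=.
  by have : 0 <= sqr_pos (t - 1); [exact: sqr_ge0|lra].
case/andP: a1 => a10 a11; case/andP: a2 => a20 a21.
by rewrite !ger0_norm//; nra.
Qed.

Context {N : nat}.
Implicit Types x : 'rV[R]_N.

Definition sqr_enorm x := \sum_(i < N) x ord0 i ^+ 2.

Definition radial_bump x := cutoff (sqr_enorm x).

Lemma sqr_enormE x : sqr_enorm x = enorm x ^+ 2.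
Proof. by rewrite sqr_sqrtr// sumr_ge0// => i _; exact: sqr_ge0. Qed.

Lemma sqr_enorm_differentiable x : differentiable sqr_enorm x.
Proof.
rewrite (_ : sqr_enorm = \sum_(i < N) (fun x => x ord0 i) ^+ 2); last first.
  by apply/funext => y; rewrite fct_sumE; apply: eq_bigr => i _.
by apply: differentiable_sum => i; apply: differentiableX; exact: differentiable_coord.
Qed.

Lemma bump_differentiable x : differentiable radial_bump x.
Proof.
apply: (differentiable_comp (f := sqr_enorm) (g := cutoff)).
  exact: sqr_enorm_differentiable.
apply/derivable1_diffP; exact: (@ex_derive _ _ _ _ _ _ _ (is_derive_cutoff _)).
Qed.

Lemma grad_bump x : grad radial_bump x = (dcutoff (sqr_enorm x) * 2) *: x.
Proof.
apply/rowP => i; rewrite !mxE.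
set q := sqr_enorm x; set a := x ord0 i.
pose g (h : R) := q + (2 * a * h + h ^+ 2).
have dg : is_derive (0 : R) 1 g (2 * a).
  by apply: is_derive_quadratic_error => h; rewrite /g ler_norml; apply/andP; split; nra.
have g0 : g 0 = q by rewrite /g; ring.
have dcg : is_derive (0 : R) 1 (cutoff \o g) (dcutoff q * (2 * a)).
  by apply: is_derive1_comp; rewrite g0; exact: is_derive_cutoff.
have E : (fun h : R => h^-1 *:
      ((radial_bump \o shift x) (h *: (delta_mx ord0 i : 'rV[R]_N)) - radial_bump x)) =
    (fun h : R => h^-1 *: (((cutoff \o g) \o shift 0) (h *: (1 : R)) - (cutoff \o g) 0)).
  apply/funext => h; rewrite /= scaler1 addr0 g0; congr (_ *: (cutoff _ - _)).
  rewrite /g /q /sqr_enorm (bigD1 i)//= [in RHS](bigD1 i)//= !mxE !eqxx/= mulr1.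
  rewrite (eq_bigr (fun j => x ord0 j ^+ 2)); last first.
    by move=> j ji; rewrite !mxE eqxx (negbTE ji)/= mulr0 add0r.
  by rewrite -/a; ring.
by rewrite /derive E -[lim _]/('D_1 (cutoff \o g) 0) derive_val mulrA.
Qed.

Lemma sqr_enorm_continuous : continuous sqr_enorm.
Proof.
by move=> x; apply: differentiable_continuous; exact: sqr_enorm_differentiable.
Qed.

Lemma bump_supp x : radial_bump x != 0 -> sqr_enorm x <= 2.
Proof. by apply: contra_neqT; rewrite -ltNge => /ltW; exact: cutoff0. Qed.

Lemma C1c_radial_bump : C1c setT radial_bump.
Proof.
split => //.
  move=> x _; split; first exact: bump_differentiable.
  rewrite (_ : grad radial_bump = fun x => (dcutoff (sqr_enorm x) * 2) *: x); last first.
    by apply/funext => y; exact: grad_bump.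
  apply: continuousZ; last by [].
  apply: continuousM; last exact: cst_continuous.
  apply: (continuous_comp (f := sqr_enorm)); first exact: sqr_enorm_continuous.
  exact: dcutoff_continuous.
pose B := [set v : 'rV[R]_N | forall i, `[-2, 2]%classic (v ord0 i)].
apply: (@subclosed_compact _ _ B); first exact: closed_closure.
  exact: (@rV_compact R N (fun=> `[-2, 2]%classic) (fun=> @segment_compact R (-2) 2)).
have : closed [set x | sqr_enorm x <= 2].
  apply: (@closed_comp _ _ sqr_enorm [set t | t <= 2]); last exact: closed_le.
  by move=> x _; exact: sqr_enorm_continuous.
move=> /closure_id cl; apply: (@subset_trans _ [set x | sqr_enorm x <= 2]).
  by rewrite cl; apply: closure_subset => x; exact: bump_supp.
move=> x /= x2 i; rewrite /= in_itv/= -ler_norml.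
have := coord_le_enorm x i; have := enorm_ge0 x; rewrite sqr_enormE in x2.
by have := normr_ge0 (x ord0 i); nra.
Qed.

End bump.


Section divergence.
Context {R : realType} {N : nat} (Psi : R -> R) (gamma : R).
Hypotheses (N0 : (0 < N)%N) (HPsi : orlicz Psi).
Hypothesis gamma_large : N%:R <= gamma * p_minus Psi.
Implicit Types x : 'rV[R]_N.

Let gamma0 : 0 < gamma.
Proof.
have p1 := p_minus_ge1 HPsi; have p0 : 0 < p_minus Psi by rewrite (lt_le_trans ltr01).
by rewrite -(pmulr_lgt0 _ p0) (lt_le_trans _ gamma_large)// ltr0n.
Qed.

(** The scaling inequality for p^- with factor |x|^gamma <= 1, whose power p^-
is at most |x|^N. *)
Lemma orlicz_singularity x : x != 0 -> enorm x <= 1 ->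
  Psi 1 * (enorm x ^+ N)^-1 <= Psi (1 / enorm x `^ gamma).
Proof.
move=> x0 x1; have e0 : 0 < enorm x by rewrite enorm_gt0.
have g0 : 0 < enorm x `^ gamma by exact: powR_gt0.
have g1 : enorm x `^ gamma <= 1.
  by rewrite -(powRr0 (enorm x)) ger_powR ?e0// ltW.
rewrite ler_pdivrMr ?exprn_gt0//.
have := orlicz_scale_minus HPsi (ltW g0) g1 (divr_ge0 ler01 (ltW g0)).
rewrite mulrCA mulfV ?gt_eqF// mulr1 => /le_trans; apply.
rewrite mulrC ler_wpM2l ?(orlicz_ge0 HPsi) ?divr_ge0 ?(ltW g0)//.
by rewrite -powRrM -powR_mulrn ?enorm_ge0// ger_powR// e0.
Qed.

Let Q k : set 'rV[R]_N := cube (2 ^- k.+1) (2 ^- k).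

Let enorm_Q k x : Q k x -> 0 < enorm x <= N%:R * 2 ^- k.
Proof.
move=> Qx.
have xi i : 0 < x ord0 i /\ x ord0 i <= 2 ^- k.
  have := Qx i; rewrite /= in_itv/= => /andP[h1 h2]; split; last exact: ltW.
  by apply: lt_le_trans h1; rewrite invr_gt0 exprn_gt0.
apply/andP; split.
  apply: lt_le_trans (coord_le_enorm x (Ordinal N0)).
  by rewrite normr_gt0 gt_eqF// (xi _).1.
have k0 : 0 <= 2 ^- k :> R by rewrite invr_ge0 exprn_ge0.
rewrite -(@ler_pXn2r _ 2) ?nnegrE ?enorm_ge0 ?mulr_ge0//.
rewrite -sqr_enormE exprMn.
apply: (@le_trans _ _ (\sum_(i < N) (2 ^- k) ^+ 2)).
  apply: ler_sum => i _; have [h1 h2] := xi i.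
  by rewrite lerXn2r ?nnegrE// ltW.
rewrite sumr_const card_ord -[leLHS]mulr_natl ler_wpM2r ?sqr_ge0//.
by rewrite expr2 ler_peMl// ler1n.
Qed.

(** On each of the disjoint cubes [2^-(k+1), 2^-k)^N the function |x|^-N has an
integral bounded below independently of k. *)
Lemma hardy_lhs_infinite (u : 'rV[R]_N -> R) (d : R) : continuous u -> 0 < d ->
  (forall x, enorm x <= d -> u x = 1) ->
  (\int[lebesgue_rV N]_x (hardy_lhs Psi gamma u x)%:E = +oo)%E.
Proof.
move=> cu d0 u1.
pose d1 := Num.min d 1.
have d10 : 0 < d1 by rewrite lt_min d0 ltr01.
have [m Hm] : exists m, forall k, (m <= k)%N -> N%:R * 2 ^- k <= d1 :> R.
  pose m := Num.bound (N%:R / d1); exists m => k mk.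
  rewrite ler_pdivrMr ?exprn_gt0// -ler_pdivrMl// mulrC.
  apply: (le_trans (ltW (archi_boundP (divr_ge0 (ler0n _ _) (ltW d10))))).
  by rewrite -natrX ler_nat (leq_trans mk)// ltnW// ltn_expl.
(* on the k-th cube |x| <= N 2^-k, and the cube has volume 2^(-(k+1) N) *)
pose c := Psi 1 * (N%:R ^+ N * 2 ^+ N)^-1.
have N0R : 0 < N%:R :> R by rewrite ltr0n.
have P1 : 0 < Psi 1 by exact: orlicz_gt0.
have c0 : 0 < c by rewrite mulr_gt0// invr_gt0 mulr_gt0 ?exprn_gt0.
have mlhs : measurable_fun [set: 'rV[measurableTypeR R]_N] (EFin \o hardy_lhs Psi gamma u).
  by apply/measurable_EFinP; exact: measurable_hardy_lhs.
have lhs0 x : (0 <= (hardy_lhs Psi gamma u x)%:E)%E by rewrite lee_fin hardy_lhs_ge0.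
have mQ k : measurable (Q k : set 'rV[measurableTypeR R]_N) by exact: measurable_cube.
have IQ k : (m <= k)%N ->
    (c%:E <= \int[lebesgue_rV N]_(x in Q k) (hardy_lhs Psi gamma u x)%:E)%E.
  move=> mk.
  pose b := Psi 1 * ((N%:R * 2 ^- k) ^+ N)^-1.
  have k0 : 0 < 2 ^- k :> R by rewrite invr_gt0 exprn_gt0.
  have b0 : 0 <= b by rewrite mulr_ge0 ?invr_ge0 ?exprn_ge0 ?mulr_ge0 ?(ltW P1) ?(ltW k0).
  have -> : (c%:E = \int[lebesgue_rV N]_(x in Q k) (cst b%:E) x)%E.
    have kS : 2 ^- k.+1 <= 2 ^- k :> R by rewrite lef_pV2 ?posrE ?exprn_gt0// ler_eXn2l ?ltr1n.
    rewrite integral_cube_cst//; congr EFin.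
    have -> : 2 ^- k - 2 ^- k.+1 = 2 ^- k * 2^-1 :> R by rewrite exprSr; field; rewrite expf_neq0.
    rewrite /b /c !exprMn !invfM; set a := (2 ^- k) ^+ N.
    have a0 : a != 0 by rewrite expf_neq0// gt_eqF.
    by rewrite exprVn; field; rewrite a0 !expf_neq0// gt_eqF.
  apply: ge0_le_integral => //.
  - exact: mQ.
  - exact: measurable_funS mlhs.
  move=> x Qx; rewrite lee_fin; have /andP[x0 xk] := enorm_Q Qx.
  have xd : enorm x <= d1 by rewrite (le_trans xk)// Hm.
  rewrite /hardy_lhs u1 ?normr1; last by rewrite (le_trans xd)// ge_min lexx.
  apply: le_trans (orlicz_singularity _ _); last 2 first.
  - by rewrite -enorm_gt0.
  - by rewrite (le_trans xd)// ge_min lexx orbT.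
  rewrite ler_wpM2l ?(ltW P1)// lef_pV2 ?posrE ?exprn_gt0 ?mulr_gt0//.
  by rewrite lerXn2r ?nnegrE ?enorm_ge0 ?mulr_ge0 ?(ltW k0).
have disj i j x : (i < j)%N -> Q i x -> Q j x -> False.
  move=> lij /(_ (Ordinal N0)) + /(_ (Ordinal N0)).
  rewrite /= !in_itv/= => /andP[h2 _] /andP[_ h1].
  have h : 2 ^- j <= 2 ^- i.+1 :> R.
    by rewrite lef_pV2 ?posrE ?exprn_gt0// ler_eXn2l ?ltr1n.
  by have := lt_le_trans h1 (le_trans h h2); rewrite ltxx.
have tQ : trivIset setT Q.
  apply/trivIsetP => i j _ _ ij; apply/seteqP; split => // x [Qi Qj].
  have [lij|lji|eij] := ltngtP i j; [exact: disj Qi Qj|exact: disj Qj Qi|].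
  by rewrite eij eqxx in ij.
apply/eqyP => A A0.
have cA : 0 < A / c by rewrite divr_gt0.
pose K := Num.bound (A / c).
pose s := iota m K.
have us : uniq s by exact: iota_uniq.
pose D := \big[setU/set0]_(k <- s) Q k.
have mD : measurable (D : set 'rV[measurableTypeR R]_N) by apply: bigsetU_measurable.
apply: (@le_trans _ _ (\int[lebesgue_rV N]_(x in D) (hardy_lhs Psi gamma u x)%:E)%E); last first.
  by apply: ge0_subset_integral.
rewrite (ge0_integral_bigsetU (lebesgue_rV N) mQ us)//; last 2 first.
- by move=> i j _ _; exact: tQ.
- exact: measurable_funS mlhs.
apply: (@le_trans _ _ (\sum_(k <- s) c%:E)%E); last first.
  rewrite big_seq [leRHS]big_seq; apply: lee_sum => k.
  by rewrite mem_iota => /andP[mk _]; exact: IQ.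
rewrite sumEFin lee_fin big_const_seq count_predT size_iota iter_addr_0 -mulr_natr.
rewrite -ler_pdivrMl// mulrC ltW//.
exact: archi_boundP (ltW cA).
Qed.

End divergence.

(** * Equivalent Orlicz functions *)

Section optimal_exponents.
Context {R : realType} {Phi : R -> R}.
Hypothesis HPhi : orlicz Phi.

Lemma orlicz_equiv_refl : orlicz_equiv Phi Phi.
Proof. by exists 1, 1; split => // t t0; rewrite mul1r lexx. Qed.

Lemma p_oplus_ge1 : 1 <= p_oplus Phi.
Proof.
apply: lb_le_inf; last by move=> _ [Psi [HPsi _] <-]; exact: p_plus_ge1.
by exists (p_plus Phi), Phi => //; split => //; exact: orlicz_equiv_refl.
Qed.

Lemma subcritical_exponent (n gamma : R) : 0 < n -> gamma < n / p_oplus Phi ->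
  exists Psi, [/\ orlicz Psi, orlicz_equiv Psi Phi & gamma * p_plus Psi < n].
Proof.
move=> n0; have p1 := p_oplus_ge1; have p0 := lt_le_trans ltr01 p1.
rewrite ltr_pdivlMr// => gp.
have [g0|g0] := leP gamma 0.
  exists Phi; split => //; first exact: orlicz_equiv_refl.
  by rewrite (le_lt_trans _ n0)// mulr_le0_ge0// (le_trans ler01)// p_plus_ge1.
have [||_ [Psi [HPsi PP] <-]] := @inf_lt _ [set p_plus Psi | Psi in
    [set Psi | orlicz Psi /\ orlicz_equiv Psi Phi]] (n / gamma).
- by exists (p_plus Phi), Phi => //; split => //; exact: orlicz_equiv_refl.
- by rewrite ltr_pdivlMr// mulrC.
by rewrite ltr_pdivlMr// mulrC => H; exists Psi.
Qed.

Lemma supercritical_exponent (n gamma : R) : 0 < n -> n / p_ominus Phi < gamma ->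
  exists Psi, [/\ orlicz Psi, orlicz_equiv Psi Phi & n < gamma * p_minus Psi].
Proof.
move=> n0; rewrite /p_ominus; set A := [set _ | _ in _] => ng.
have AP : A (p_minus Phi) by exists Phi => //; split => //; exact: orlicz_equiv_refl.
suff [_ [Psi [HPsi PP] <-] H] : exists2 y, A y & n < gamma * y by exists Psi.
(* an unbounded A, of supremum 0 by convention, has elements above n / gamma *)
have [ub|/has_ubPn nub] := pselect (has_ubound A).
  have s0 : 0 < sup A.
    by rewrite (lt_le_trans ltr01)// (le_trans (p_minus_ge1 HPhi))// ub_le_sup.
  have g0 : 0 < gamma by rewrite (lt_trans _ ng)// divr_gt0.
  have [||y Ay] := @sup_gt _ A (n / gamma); first by exists (p_minus Phi).
    by rewrite ltr_pdivrMr// mulrC -ltr_pdivrMr.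
  by rewrite ltr_pdivrMr// mulrC => ?; exists y.
have g0 : 0 < gamma.
  have s0 : sup A = 0 by apply: sup_out => -[_]; exact/has_ubPn.
  by move: ng; rewrite s0 invr0 mulr0.
have [y Ay] := nub (n / gamma).
by rewrite ltr_pdivrMr// mulrC => ?; exists y.
Qed.

End optimal_exponents.

Section transfer.
Context {R : realType} {N : nat} (Phi Psi : R -> R) (alpha gamma : R).
Hypotheses (HPhi : orlicz Phi) (HPsi : orlicz Psi) (PP : orlicz_equiv Psi Phi).

(** Both sides change by bounded factors only. *)
Lemma hardy_transfer : exists2 c, 0 < c &
  forall (K : R) (z u : 'rV[R]_N -> R), 0 <= K -> test_function u ->
    measurable_fun [set: 'rV[measurableTypeR R]_N] z -> (forall x, 0 <= z x) ->
    (\int[lebesgue_rV N]_x (z x * hardy_lhs Psi gamma u x)%:E <=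
     K%:E * \int[lebesgue_rV N]_x (hardy_rhs Psi alpha u x)%:E)%E ->
    (\int[lebesgue_rV N]_x (z x * hardy_lhs Phi gamma u x)%:E <=
     (c * K)%:E * \int[lebesgue_rV N]_x (hardy_rhs Phi alpha u x)%:E)%E.
Proof.
have [C1 [C2 [C10 C20 CP]]] := PP.
exists (C2 / C1); first exact: divr_gt0.
move=> K z u K0 tu mz z0 H.
have ml1 : measurable_fun [set: 'rV[measurableTypeR R]_N] (hardy_lhs Phi gamma u).
  exact: measurable_hardy_lhs (test_continuous tu).
have ml2 : measurable_fun [set: 'rV[measurableTypeR R]_N] (hardy_lhs Psi gamma u).
  exact: measurable_hardy_lhs (test_continuous tu).
have mr1 : measurable_fun [set: 'rV[measurableTypeR R]_N] (hardy_rhs Phi alpha u).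
  exact: measurable_hardy_rhs (test_grad_continuous tu).
have mr2 : measurable_fun [set: 'rV[measurableTypeR R]_N] (hardy_rhs Psi alpha u).
  exact: measurable_hardy_rhs (test_grad_continuous tu).
have L : (\int[lebesgue_rV N]_x (z x * hardy_lhs Phi gamma u x)%:E <=
    C2%:E * \int[lebesgue_rV N]_x (z x * hardy_lhs Psi gamma u x)%:E)%E.
  rewrite -ge0_integralZl_EFin//; last 3 first.
  - by move=> x _; rewrite lee_fin mulr_ge0// hardy_lhs_ge0.
  - by apply/measurable_EFinP; exact: measurable_funM.
  - exact: ltW.
  apply: ge0_le_integral => //.
  - by move=> x _; rewrite lee_fin mulr_ge0// hardy_lhs_ge0.
  - by apply/measurable_EFinP; exact: measurable_funM.
  - under eq_fun do rewrite -EFinM.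
    by apply/measurable_EFinP; apply: measurable_funM => //; exact: measurable_funM.
  move=> x _; rewrite -EFinM lee_fin mulrCA ler_wpM2l//.
  have a0 : 0 <= `|u x| / enorm x `^ gamma by rewrite divr_ge0// powR_ge0.
  by have /andP[] := CP _ a0.
have Rr : (\int[lebesgue_rV N]_x (hardy_rhs Psi alpha u x)%:E <=
    C1^-1%:E * \int[lebesgue_rV N]_x (hardy_rhs Phi alpha u x)%:E)%E.
  rewrite -ge0_integralZl_EFin//; last 3 first.
  - by move=> x _; rewrite lee_fin hardy_rhs_ge0.
  - exact/measurable_EFinP.
  - by rewrite invr_ge0 ltW.
  apply: ge0_le_integral => //.
  - by move=> x _; rewrite lee_fin hardy_rhs_ge0.
  - exact/measurable_EFinP.
  - under eq_fun do rewrite -EFinM.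
    by apply/measurable_EFinP; exact: measurable_funM.
  move=> x _; rewrite -EFinM lee_fin ler_pdivlMl//.
  have a0 : 0 <= enorm x `^ alpha * enorm (grad u x) by rewrite mulr_ge0 ?powR_ge0 ?enorm_ge0.
  by have /andP[] := CP _ a0.
apply: (le_trans L).
have -> : C2 / C1 * K = C2 * (K * C1^-1) by ring.
rewrite EFinM -muleA lee_wpmul2l//; first by rewrite lee_fin ltW.
apply: (le_trans H); rewrite EFinM -muleA lee_wpmul2l// lee_fin.
Qed.

End transfer.

Section failure.
Context {R : realType} {N : nat} (Phi Psi : R -> R) (alpha gamma : R).
Hypotheses (N0 : (0 < N)%N) (HPhi : orlicz Phi) (HPsi : orlicz Psi).
Hypothesis PP : orlicz_equiv Psi Phi.
Hypothesis gamma_large : N%:R <= gamma * p_minus Psi.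

(** The integrand is bounded and lives in the shell 1 <= |x| <= 2, where the
sign of alpha does not matter. *)
Lemma hardy_rhs_bump_lty :
  (\int[lebesgue_rV N]_x (hardy_rhs Phi alpha (@radial_bump R N) x)%:E < +oo)%E.
Proof.
have tb := C1c_test_function (@C1c_radial_bump R N).
pose B := ((1 `^ - alpha)^-1 + (2 `^ - alpha)^-1) * 16.
have B0 : 0 <= B by rewrite mulr_ge0// addr_ge0// invr_ge0 powR_ge0.
have ring x : hardy_rhs Phi alpha (@radial_bump R N) x != 0 -> 1 <= enorm x <= 2.
  move=> nz.
  have dn : dcutoff (sqr_enorm x) != 0.
    apply: contra_neq nz => d0.
    by rewrite /hardy_rhs grad_bump d0 mul0r scale0r enorm0 mulr0 (orlicz0 HPhi).
  have e0 := enorm_ge0 x.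
  rewrite !leNgt -!negb_or; apply: contra dn => /orP h; apply/eqP/dcutoff_eq0.
  by rewrite sqr_enormE; case: h => h; [left|right]; nra.
apply: (@integral_bounded_lty _ _ _ (Phi B) 2).
- exact: measurable_hardy_rhs (test_grad_continuous tb).
- move=> x; rewrite hardy_rhs_ge0//=.
  have [->|/ring/andP[x1 x2]] := eqVneq (hardy_rhs Phi alpha radial_bump x) 0.
    exact: (orlicz_ge0 HPhi).
  apply: (orlicz_le HPhi); first by rewrite mulr_ge0 ?powR_ge0 ?enorm_ge0.
  apply: ler_pM; rewrite ?powR_ge0 ?enorm_ge0//.
    have := powRN_between (- alpha) ltr01 x1 x2.
    by rewrite [X in X^-1 <= _]powRN invrK.
  rewrite grad_bump enormZ normrM [`|2|]ger0_norm//.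
  have := dcutoff_bnd (sqr_enorm x); have := normr_ge0 (dcutoff (sqr_enorm x)).
  by nra.
- by move=> x /ring/andP[].
Qed.

(** The gradient of the cutoff function vanishes where |x|^-gamma is singular. *)
Lemma hardy_fails (C : R) : ~ hardy alpha gamma Phi [set: 'rV[R]_N] C.
Proof.
move=> /(_ radial_bump C1c_radial_bump).
have tb := C1c_test_function (@C1c_radial_bump R N).
have fin := hardy_rhs_bump_lty.
have -> : (\int[lebesgue_rV N]_x (Phi (`|(@radial_bump R N) x| / enorm x `^ gamma))%:E = +oo)%E.
  have [C1 [C2 [C10 C20 CP]]] := PP.
  apply/eqP; rewrite -leye_eq.
  have inf : (\int[lebesgue_rV N]_x (hardy_lhs Psi gamma (@radial_bump R N) x)%:E = +oo)%E.
    apply: (hardy_lhs_infinite N0 HPsi gamma_large (test_continuous tb) ltr01).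
    move=> x x1; apply: cutoff1; rewrite sqr_enormE.
    by have := enorm_ge0 x; nra.
  have ml1 : measurable_fun [set: 'rV[measurableTypeR R]_N] (hardy_lhs Phi gamma radial_bump).
    exact: measurable_hardy_lhs (test_continuous tb).
  have ml2 : measurable_fun [set: 'rV[measurableTypeR R]_N] (hardy_lhs Psi gamma radial_bump).
    exact: measurable_hardy_lhs (test_continuous tb).
  have -> : (+oo = \int[lebesgue_rV N]_x (C1%:E * (hardy_lhs Psi gamma (@radial_bump R N) x)%:E))%E.
    rewrite ge0_integralZl_EFin//; last 3 first.
    - by move=> x _; rewrite lee_fin hardy_lhs_ge0.
    - exact/measurable_EFinP.
    - exact: ltW.
    by rewrite inf gt0_muley// lte_fin.
  apply: ge0_le_integral => //.
  - by move=> x _; rewrite -EFinM lee_fin mulr_ge0 ?hardy_lhs_ge0// ltW.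
  - under eq_fun do rewrite -EFinM.
    by apply/measurable_EFinP; exact: measurable_funM.
  - exact/measurable_EFinP.
  move=> x _; rewrite -EFinM lee_fin.
  have a0 : 0 <= `|(@radial_bump R N) x| / enorm x `^ gamma by rewrite divr_ge0// powR_ge0.
  by have /andP[] := CP _ a0.
rewrite leye_eq => /eqP h.
have : (C%:E * \int[lebesgue_rV N]_x (hardy_rhs Phi alpha (@radial_bump R N) x)%:E)%E
    \is a fin_num.
  rewrite fin_numM// ge0_fin_numE//.
  by apply: integral_ge0 => x _; rewrite lee_fin hardy_rhs_ge0.
by rewrite [X in X \is a fin_num](_ : _ = +oo%E).
Qed.

End failure.

(** * The theorem *)

Section dilation_factors.
Context {R : realType} {Psi : R -> R}.
Hypothesis HPsi : orlicz Psi.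
Implicit Types gamma : R.

(** For gamma < 0 monotonicity alone gives the factor 1, whence the maximum. *)
Lemma dilation_factor2 gamma t : 0 <= t ->
  Psi (2 `^ gamma * t) <= 2 `^ (Num.max 0 gamma * p_plus Psi) * Psi t.
Proof.
move=> t0; have [g0|g0] := leP 0 gamma.
  rewrite powRrM; apply: (orlicz_scale_plus HPsi) => //.
  by rewrite -[leLHS](powRr0 2) ler_powR// ler1n.
rewrite mul0r powRr0 mul1r; apply: (orlicz_le HPsi).
  by rewrite mulr_ge0// powR_ge0.
by rewrite ler_piMl// -[leRHS](powRr0 2) ler_powR ?ler1n// ltW.
Qed.

Lemma dilation_factorV2 gamma t : 0 <= gamma -> 0 <= t ->
  Psi (2^-1 `^ gamma * t) <= 2^-1 `^ (gamma * p_minus Psi) * Psi t.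
Proof.
move=> g0 t0; rewrite powRrM; apply: (orlicz_scale_minus HPsi) => //.
rewrite -[leRHS](powRr0 2^-1) ger_powR// invr_gt0 ltr0n/=.
by rewrite invf_le1// ler1n.
Qed.

End dilation_factors.

Lemma supp_hardy_rhs (R : realType) N (Phi : R -> R) (alpha : R) (u : 'rV[R]_N -> R)
    (D : set 'rV[R]_N) : orlicz Phi -> supp u `<=` D ->
  (\int[lebesgue_rV N]_(x in D) (hardy_rhs Phi alpha u x)%:E =
   \int[lebesgue_rV N]_x (hardy_rhs Phi alpha u x)%:E)%E.
Proof.
move=> HPhi uD; rewrite integral_mkcond; apply: eq_integral => x _.
rewrite patchE; case: ifPn => // /negP xD.
rewrite /hardy_rhs grad_eq0 ?enorm0 ?mulr0 ?(orlicz0 HPhi)//.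
by apply: near_notin_supp => /uD Dx; apply: xD; exact: mem_set.
Qed.

(** The two logarithmic inequalities, once the index p^+ or p^- that makes the
dilation by lam critical has been identified. *)
Lemma log_hardy (R : realType) N (Phi Psi : R -> R) (alpha gamma lam theta : R)
    (D : set 'rV[R]_N) (L : 'rV[R]_N -> R) :
  (0 < N)%N -> orlicz Phi -> orlicz Psi -> orlicz_equiv Psi Phi ->
  gamma = 1 - alpha -> 2^-1 <= lam <= 2 ->
  (forall t, 0 <= t -> Psi (lam `^ gamma * t) <= theta * Psi t) -> 0 <= theta ->
  lam^-1 ^+ N * theta = 1 ->
  measurable (D : set 'rV[measurableTypeR R]_N) ->
  measurable_fun [set: 'rV[measurableTypeR R]_N] L ->
  (forall x, D x -> D (lam^-1 *: x)) ->
  (forall x, x != 0 -> D x -> ln 2 <= L x) ->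
  (forall x, x != 0 -> D x -> L (lam^-1 *: x) = L x + ln 2) ->
  (1 <= lam \/ exists2 r, 0 < r & forall x, enorm x < r -> ~ D x) ->
  exists C : R, 0 < C /\
    forall u : 'rV[R]_N -> R, C1c setT u -> supp u `<=` D ->
      (\int[lebesgue_rV N]_(x in D)
         (Phi (enorm x `^ (- gamma) * `|u x|) / L x `^ p_plus Psi)%:E <=
       C%:E * \int[lebesgue_rV N]_(x in D)
         (Phi (enorm x `^ alpha * enorm (grad u x)))%:E)%E.
Proof.
move=> N0 HPhi HPsi PP gE lb tb t0 crit mD mL DV DL LV cond.
have [K K0 HK] := critical_hardy N0 HPsi gE lb tb t0 crit mL DV DL LV.
have [c c0 Hc] := hardy_transfer (N := N) alpha gamma HPhi HPsi PP.
exists (c * K); split; first exact: mulr_gt0.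
move=> u Cu uD; have tu := C1c_test_function Cu.
have uD' x : u x != 0 -> D x by move=> ux; apply: uD; exact: subset_supp.
have mz : measurable_fun [set: 'rV[measurableTypeR R]_N] (fun x => L x `^ (- p_plus Psi)).
  exact: (measurableT_comp (@measurable_powR R _) mL).
have := Hc K (fun x => L x `^ (- p_plus Psi)) u (ltW K0) tu mz (fun=> powR_ge0 _ _).
have cond' : 1 <= lam \/ exists2 r, 0 < r & forall x, enorm x < r -> u x = 0.
  case: cond => [|[r r0 rD]]; [by left|right; exists r => // x /rD nDx].
  by apply/eqP; apply: contrapT => /negP /uD'.
move=> /(_ (HK u tu uD' cond')).
rewrite -(supp_hardy_rhs alpha HPhi uD); apply: le_trans.
have mlhs : measurable_fun [set: 'rV[measurableTypeR R]_N] (hardy_lhs Phi gamma u).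
  exact: measurable_hardy_lhs (test_continuous tu).
apply: (@le_trans _ _ (\int[lebesgue_rV N]_(x in D)
    (L x `^ (- p_plus Psi) * hardy_lhs Phi gamma u x)%:E)%E).
  rewrite le_eqVlt; apply/orP; left; apply/eqP; apply: eq_integral => x _.
  by rewrite /hardy_lhs !powRN mulrC [_^-1 * `|_|]mulrC.
apply: ge0_subset_integral => //.
- by apply/measurable_EFinP; exact: measurable_funM.
- by move=> x _; rewrite lee_fin mulr_ge0 ?powR_ge0// hardy_lhs_ge0.
Qed.

Theorem theorem4p2 (R : realType) (N : nat) (r alpha gamma : R) (Phi : R -> R) :
  (1 <= N)%N -> 0 < r -> gamma = 1 - alpha -> orlicz Phi ->
  (gamma < N%:R / p_oplus Phi ->
    exists C : R, 0 < C /\ hardy alpha gamma Phi [set: 'rV[R]_N] C) /\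
  (gamma > N%:R / p_ominus Phi ->
    exists C : R, 0 < C /\ hardy alpha gamma Phi (~` [set (0 : 'rV[R]_N)]) C) /\
  (oplus_attained Phi -> gamma = N%:R / p_oplus Phi ->
    exists C : R, 0 < C /\
    forall u : 'rV[R]_N -> R, C1c setT u -> supp u `<=` eball r ->
      (\int[lebesgue_rV N]_(x in eball r)
         (Phi (enorm x `^ (- gamma) * `|u x|) /
          ln (2 * r / enorm x) `^ p_oplus Phi)%:E <=
       C%:E * \int[lebesgue_rV N]_(x in eball r)
         (Phi (enorm x `^ alpha * enorm (grad u x)))%:E)%E) /\
  (forall Psi : R -> R, ominus_attained_at Phi Psi ->
    gamma = N%:R / p_ominus Phi ->
    exists C : R, 0 < C /\
    forall u : 'rV[R]_N -> R, C1c setT u -> supp u `<=` ~` eball r ->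
      (\int[lebesgue_rV N]_(x in ~` eball r)
         (Phi (enorm x `^ (- gamma) * `|u x|) /
          ln (2 * enorm x / r) `^ p_plus Psi)%:E <=
       C%:E * \int[lebesgue_rV N]_(x in ~` eball r)
         (Phi (enorm x `^ alpha * enorm (grad u x)))%:E)%E) /\
  (gamma > N%:R / p_ominus Phi ->
    forall C : R, 0 < C -> ~ hardy alpha gamma Phi [set: 'rV[R]_N] C) /\
  (ominus_attained Phi -> gamma = N%:R / p_ominus Phi ->
    forall C : R, 0 < C -> ~ hardy alpha gamma Phi [set: 'rV[R]_N] C).
Proof.
move=> N0 r0 gE HPhi; have N0R : 0 < N%:R :> R by rewrite ltr0n.
have two : 2^-1 <= (2 : R) <= 2.
  by rewrite lexx andbT (@le_trans _ _ 1)// ?invf_le1// ler1n.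
have half : 2^-1 <= (2^-1 : R) <= 2 by rewrite lexx/=; case/andP: two.
have measurable_enormV : measurable_fun [set: 'rV[measurableTypeR R]_N]
    (fun x => (@enorm R N x)^-1).
  rewrite (_ : (fun _ => _) = (fun x => @enorm R N x `^ (- 1))).
    exact: measurable_enorm_powR.
  by apply/funext => x; rewrite powR_inv1// enorm_ge0.
have one_mul (f : 'rV[R]_N -> R) : (\int[lebesgue_rV N]_x (cst 1 x * f x)%:E =
    \int[lebesgue_rV N]_x (f x)%:E)%E.
  by apply: eq_integral => x _; rewrite mul1r.
repeat split.
- (* dilation by 2, a contraction because gamma * p_plus Psi < N *)
  move=> /(subcritical_exponent HPhi N0R)[Psi [HPsi PP gp]].
  have rho1 : (2^-1 ^+ N * 2 `^ (Num.max 0 gamma * p_plus Psi) < 1).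
    by apply: powR2_lt1; have [g0|g0] := leP 0 gamma; rewrite ?mul0r.
  have [K K0 HK] := subcritical_hardy N0 HPsi gE two
    (@dilation_factor2 _ _ HPsi gamma) (powR_ge0 _ _) rho1.
  have [c c0 Hc] := hardy_transfer (N := N) alpha gamma HPhi HPsi PP.
  exists (c * K); split; first exact: mulr_gt0.
  move=> u /C1c_test_function tu.
  have := Hc K (cst 1) u (ltW K0) tu (@measurable_cst _ _ _ _ _ _) (fun=> ler01).
  by rewrite !one_mul; apply; apply: HK => //; left; rewrite ler1n.
- (* dilation by 1/2, a contraction because N < gamma * p_minus Psi *)
  move=> /(supercritical_exponent HPhi N0R)[Psi [HPsi PP gp]].
  have g0 : 0 <= gamma.
    have p0 : 0 < p_minus Psi by rewrite (lt_le_trans ltr01)// p_minus_ge1.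
    by rewrite -(pmulr_lge0 _ p0) ltW// (lt_trans N0R).
  have [K K0 HK] := subcritical_hardy N0 HPsi gE half
    (fun t t0 => dilation_factorV2 HPsi g0 t0) (powR_ge0 _ _) (powRV2_lt1 gp).
  have [c c0 Hc] := hardy_transfer (N := N) alpha gamma HPhi HPsi PP.
  exists (c * K); split; first exact: mulr_gt0.
  move=> u /C1c_punctured_test_function[tu u0].
  have := Hc K (cst 1) u (ltW K0) tu (@measurable_cst _ _ _ _ _ _) (fun=> ler01).
  by rewrite !one_mul; apply; apply: HK => //; right.
- (* dilation by 2 is neutral, and the logarithm grows towards the origin *)
  move=> [Psi [HPsi PP pE]] gN.
  have p1 : 1 <= p_plus Psi by exact: p_plus_ge1.
  have p0 : 0 < p_plus Psi by rewrite (lt_le_trans ltr01).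
  have g0 : 0 <= gamma by rewrite gN pE divr_ge0// ltW.
  rewrite pE.
  apply: (@log_hardy R N Phi Psi alpha gamma 2 (2 `^ (Num.max 0 gamma * p_plus Psi))
    (eball r) (fun x => ln (2 * r / enorm x))) => //.
  + by move=> t; exact: dilation_factor2.
  + rewrite max_r// gN pE divfK ?gt_eqF// powR_mulrn// -exprMn mulVf ?expr1n//.
  + exact: measurable_eball.
  + apply: measurableT_comp; first exact: measurable_ln.
    exact: measurable_funM.
  + move=> x; rewrite /eball/= enormZ gtr0_norm ?invr_gt0// => xr.
    by rewrite ltr_pdivrMl// (lt_trans xr)// ltr_pMl// ltr1n.
  + move=> x x0; rewrite /eball/= => xr; have e0 : 0 < enorm x by rewrite enorm_gt0.
    by rewrite ler_ln ?posrE ?divr_gt0 ?mulr_gt0// ler_pdivlMr// ler_wpM2l// ltW.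
  + move=> x x0 _; have e0 : 0 < enorm x by rewrite enorm_gt0.
    rewrite -lnM ?posrE ?divr_gt0 ?mulr_gt0// enormZ gtr0_norm ?invr_gt0//.
    by congr ln; field; rewrite gt_eqF.
  + by left; rewrite ler1n.
- (* dilation by 1/2 is neutral, and the logarithm grows towards infinity *)
  move=> Psi [HPsi PP pE] gN.
  have p1 : 1 <= p_minus Psi by exact: p_minus_ge1.
  have p0 : 0 < p_minus Psi by rewrite (lt_le_trans ltr01).
  have g0 : 0 <= gamma by rewrite gN pE divr_ge0// ltW.
  have ball x : (~` eball r) x -> r <= enorm x.
    by rewrite /eball/= => /negP; rewrite -leNgt.
  apply: (@log_hardy R N Phi Psi alpha gamma 2^-1 (2^-1 `^ (gamma * p_minus Psi))
    (~` eball r) (fun x => ln (2 * enorm x / r))) => //.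
  + by move=> t; exact: dilation_factorV2.
  + rewrite gN pE divfK ?gt_eqF// powR_mulrn ?invr_ge0// -exprMn invrK.
    by rewrite mulfV ?expr1n.
  + by apply: measurableC; exact: measurable_eball.
  + apply: measurableT_comp; first exact: measurable_ln.
    by apply: measurable_funM => //; apply: measurable_funM => //; exact: measurable_enorm.
  + move=> x /ball xr; rewrite /eball/= invrK enormZ ger0_norm//.
    by apply/negP; rewrite -leNgt (le_trans xr)// ler_peMl ?enorm_ge0// ler1n.
  + move=> x x0 /ball xr; have e0 : 0 < enorm x by rewrite enorm_gt0.
    by rewrite ler_ln ?posrE ?divr_gt0 ?mulr_gt0// ler_pdivlMr// ler_wpM2l.
  + move=> x x0 _; have e0 : 0 < enorm x by rewrite enorm_gt0.
    rewrite -lnM ?posrE ?divr_gt0 ?mulr_gt0// invrK enormZ ger0_norm//.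
    by congr ln; field; rewrite gt_eqF.
  + by right; exists r => // x xr; rewrite /eball/=; apply.
- move=> /(supercritical_exponent HPhi N0R)[Psi [HPsi PP /ltW gp]] C _.
  exact: (hardy_fails N0 HPhi HPsi PP gp).
- move=> [Psi [HPsi PP pE]] gN C _.
  apply: (hardy_fails N0 HPhi HPsi PP).
  by rewrite gN pE divfK// gt_eqF// (lt_le_trans ltr01)// p_minus_ge1.
Qed.
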